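(* If $G$ is a hyperbolic group such that $\mathrm{cd}_{\mathbb{Z}}(G)=3$ and $G$ contains a non-hyperbolic finitely presented subgroup, then $\mathrm{cd}_{\mathbb{Q}}(G)=\mathrm{cd}_{\mathbb{Z}}(G)$.
   Context: For a group $G$ and a ring $R$, $\mathrm{cd}_R(G)$ denotes the cohomological dimension of $G$ over $R$: the minimal length of a projective resolution of the trivial $RG$-module $R$. ''Hyperbolic'' means word hyperbolic in the sense of Gromov. *)

(* Defs.v *)
From HB Require Import structures.
From mathcomp Require Import all_boot all_order all_algebra.
From mathcomp Require Import finmap monalg boolp.

Set Implicit Arguments.
Unset Strict Implicit.
Unset Printing Implicit Defensive.

Import Order.TTheory GRing.Theory Num.Theory.

Local Open Scope ring_scope.

(* The group ring R[G] of a possibly infinite group.  The alias is needed    *)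
(* because {malg R[G]} is already a ring for the (conical) monoids of        *)
(* monalg, a class that excludes the nontrivial groups.                      *)

Definition group_ring (R : nzRingType) (G : groupType) : Type := {malg R[G]}.

HB.instance Definition _ R G := GRing.Zmodule.on (group_ring R G).

Section GroupRing.
Variables (R : nzRingType) (G : groupType).
Implicit Types (a b c : {malg R[G]}) (g h : G).

Definition gr_one : {malg R[G]} := << 1 *g (1%g : G) >>.

Definition gr_mul a b : {malg R[G]} :=
  \sum_(g <- msupp a) \sum_(h <- msupp b) << a@_g * b@_h *g (g * h)%g >>.

Lemma gr_mulw (A B : {fset G}) a b :
  (msupp a `<=` A)%fset -> (msupp b `<=` B)%fset ->
  gr_mul a b = \sum_(g <- A) \sum_(h <- B) << a@_g * b@_h *g (g * h)%g >>.
Proof.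
move=> sA sB; rewrite /gr_mul (big_fset_incl _ sA) /=.
  apply/eq_bigr=> g _; apply/big_fset_incl => // h _ /mcoeff_outdom ->.
  by rewrite mulr0 monalgU0.
move=> g _ /mcoeff_outdom ag.
by rewrite big1 // => h _; rewrite ag mul0r monalgU0.
Qed.

Lemma gr_mulDl : left_distributive gr_mul +%R.
Proof.
move=> a b c; pose A := (msupp a `|` msupp b)%fset.
rewrite (@gr_mulw A (msupp c) a) ?fsubsetUl //.
rewrite (@gr_mulw A (msupp c) b) ?fsubsetUr //.
rewrite (@gr_mulw A (msupp c)) ?msuppD_le //.
rewrite -big_split /=; apply/eq_bigr=> g _.
rewrite -big_split /=; apply/eq_bigr=> h _.
by rewrite mcoeffD mulrDl monalgUD.
Qed.

Lemma gr_mulDr : right_distributive gr_mul +%R.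
Proof.
move=> c a b; pose A := (msupp a `|` msupp b)%fset.
rewrite (@gr_mulw (msupp c) A c a) ?fsubsetUl //.
rewrite (@gr_mulw (msupp c) A c b) ?fsubsetUr //.
rewrite (@gr_mulw (msupp c) A) ?msuppD_le //.
rewrite -big_split /=; apply/eq_bigr=> g _.
rewrite -big_split /=; apply/eq_bigr=> h _.
by rewrite mcoeffD mulrDr monalgUD.
Qed.

Lemma gr_mul0l : left_zero 0 gr_mul.
Proof. by move=> a; rewrite /gr_mul msupp0 big_seq_fset0. Qed.

Lemma gr_mul0r : right_zero 0 gr_mul.
Proof.
by move=> a; rewrite /gr_mul big1 // => g _; rewrite msupp0 big_seq_fset0.
Qed.

Lemma gr_mulUU (r s : R) g h :
  gr_mul << r *g g >> << s *g h >> = << r * s *g (g * h)%g >>.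
Proof.
by rewrite (gr_mulw msuppU_le msuppU_le) !big_seq_fset1 !mcoeffUU.
Qed.

Lemma gr_suml (I : Type) (l : seq I) (F : I -> {malg R[G]}) b :
  gr_mul (\sum_(i <- l) F i) b = \sum_(i <- l) gr_mul (F i) b.
Proof. exact: (big_morph (gr_mul^~ b) (fun x y => gr_mulDl x y b) (gr_mul0l b)). Qed.

Lemma gr_sumr (I : Type) (l : seq I) (F : I -> {malg R[G]}) a :
  gr_mul a (\sum_(i <- l) F i) = \sum_(i <- l) gr_mul a (F i).
Proof. exact: (big_morph (gr_mul a) (gr_mulDr a) (gr_mul0r a)). Qed.

Lemma gr_mul1l : left_id gr_one gr_mul.
Proof.
move=> a; rewrite [a in LHS]monalgE gr_sumr [RHS]monalgE.
by apply/eq_bigr=> g _; rewrite gr_mulUU mul1r mul1g.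
Qed.

Lemma gr_mul1r : right_id gr_one gr_mul.
Proof.
move=> a; rewrite [a in LHS]monalgE gr_suml [RHS]monalgE.
by apply/eq_bigr=> g _; rewrite gr_mulUU mulr1 mulg1.
Qed.

Lemma gr_mulA : associative gr_mul.
Proof.
move=> a b c; rewrite [a]monalgE gr_suml !gr_suml; apply/eq_bigr=> g _.
rewrite [b]monalgE gr_suml !gr_sumr gr_suml; apply/eq_bigr=> h _.
rewrite [c]monalgE !gr_sumr; apply/eq_bigr=> k _.
by rewrite !gr_mulUU mulrA mulgA.
Qed.

Lemma gr_one_neq0 : gr_one != 0.
Proof. by rewrite monalgU_eq0 oner_neq0. Qed.

HB.instance Definition _ := GRing.Zmodule_isNzRing.Build (group_ring R G)
  gr_mulA gr_mul1l gr_mul1r gr_mulDl gr_mulDr gr_one_neq0.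

Definition augmentation (a : group_ring R G) : R := \sum_(g <- msupp a) a@_g.

Lemma augmentationw (A : {fset G}) a :
  (msupp a `<=` A)%fset -> augmentation a = \sum_(g <- A) a@_g.
Proof.
by move=> sA; apply: big_fset_incl => // g _ /mcoeff_outdom.
Qed.

Lemma augmentationU (r : R) g : augmentation << r *g g >> = r.
Proof. by rewrite (augmentationw msuppU_le) big_seq_fset1 mcoeffUU. Qed.

Lemma augmentationD : {morph augmentation : a b / a + b}.
Proof.
move=> a b; pose A := (msupp a `|` msupp b)%fset.
rewrite (@augmentationw A a) ?fsubsetUl // (@augmentationw A b) ?fsubsetUr //.
rewrite (@augmentationw A) ?msuppD_le // -big_split.
by apply/eq_bigr=> g _; rewrite mcoeffD.
Qed.

Lemma augmentation0 : augmentation 0 = 0.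
Proof. by rewrite /augmentation msupp0 big_seq_fset0. Qed.

Lemma augmentation_sum (I : Type) (l : seq I) (F : I -> group_ring R G) :
  augmentation (\sum_(i <- l) F i) = \sum_(i <- l) augmentation (F i).
Proof. exact: (big_morph _ augmentationD augmentation0). Qed.

Lemma augmentationM : {morph augmentation : a b / a * b}.
Proof.
move=> a b; rewrite [LHS]augmentation_sum /augmentation mulr_suml.
apply/eq_bigr=> g _; rewrite [LHS]augmentation_sum mulr_sumr.
by apply/eq_bigr=> h _; rewrite augmentationU.
Qed.

Lemma augmentation1 : augmentation 1 = 1.
Proof. exact: augmentationU. Qed.

End GroupRing.

(* R with the trivial action of G: every g acts as the identity, so a in R[G] *)
(* acts as its augmentation.                                                 *)
Definition trivial_module (R : nzRingType) (G : groupType) : Type := R.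

HB.instance Definition _ R G := GRing.Zmodule.on (trivial_module R G).

Section TrivialModule.
Variables (R : nzRingType) (G : groupType).

Definition tm_scale (a : group_ring R G) (x : trivial_module R G) :
  trivial_module R G := augmentation a * (x : R).

Lemma tm_scaleA a b x : tm_scale a (tm_scale b x) = tm_scale (a * b) x.
Proof. by rewrite /tm_scale augmentationM mulrA. Qed.

Lemma tm_scale1 : left_id 1 tm_scale.
Proof. by move=> x; rewrite /tm_scale augmentation1 mul1r. Qed.

Lemma tm_scaleDr : right_distributive tm_scale +%R.
Proof. by move=> a x y; rewrite /tm_scale mulrDr. Qed.

Lemma tm_scaleDl x : {morph tm_scale^~ x : a b / a + b}.
Proof. by move=> a b; rewrite /tm_scale augmentationD mulrDl. Qed.

HB.instance Definition _ := GRing.Zmodule_isLmodule.Build (group_ring R G)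
  (trivial_module R G) tm_scaleA tm_scale1 tm_scaleDr tm_scaleDl.

End TrivialModule.

Section ProjectiveDimension.
Variable S : nzRingType.

Definition projective (P : lmodType S) : Prop :=
  forall (M N : lmodType S) (p : {linear M -> N}) (f : {linear P -> N}),
    (forall y, exists x, p x = y) ->
    exists g : {linear P -> M}, forall x, p (g x) = f x.

Definition exact_at (A B C : lmodType S)
    (f : {linear A -> B}) (g : {linear B -> C}) : Prop :=
  forall b, g b = 0 <-> exists a, f a = b.

(* ... -> P 2 -> P 1 -> P 0 -> M -> 0 *)
Definition projective_resolution (M : lmodType S) (P : nat -> lmodType S)
    (d : forall i, {linear P i.+1 -> P i}) (e : {linear P 0%N -> M}) : Prop :=
  [/\ forall i, projective (P i),
      forall m, exists x, e x = m,
      exact_at (d 0%N) e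
    & forall i, exact_at (d i.+1) (d i)].

Definition has_projective_resolution (M : lmodType S) (n : nat) : Prop :=
  exists (P : nat -> lmodType S) (d : forall i, {linear P i.+1 -> P i})
         (e : {linear P 0%N -> M}),
    projective_resolution d e /\
    forall i, (n < i)%N -> forall x : P i, x = 0.

(* The value None stands for an infinite dimension. *)
Definition projective_dimension (M : lmodType S) : option nat :=
  if pselect (exists n, `[< has_projective_resolution M n >]) is left h
  then Some (ex_minn h) else None.

End ProjectiveDimension.

Definition cd (R : nzRingType) (G : groupType) : option nat :=
  projective_dimension (trivial_module R G).

(* Words in the letters s i (i, false) and (s i)^-1 (i, true).               *)

Section Words.
Variables (G : groupType) (n : nat).
Implicit Types (s : 'I_n -> G).

Definition word := seq ('I_n * bool).

Definition eval s (w : word) : G :=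
  (\prod_(l <- w) (if l.2 then (s l.1)^-1 else s l.1))%g.

Definition generates s : Prop := forall g, exists w, eval s w = g.

Lemma word_length_subproof s (hs : generates s) g :
  exists k, `[< exists w, eval s w = g /\ size w = k >].
Proof. by have [w wg] := hs g; exists (size w); apply/asboolP; exists w. Qed.

Definition word_length s (hs : generates s) g : nat :=
  ex_minn (word_length_subproof hs g).

Definition word_dist s (hs : generates s) (g h : G) : nat :=
  word_length hs (g^-1 * h)%g.

(* Equality in the group with generators 'I_n and relators rels.    *)
Inductive presented_eq (rels : seq word) : word -> word -> Prop :=
| PresRefl u : presented_eq rels u u
| PresSym u v : presented_eq rels u v -> presented_eq rels v u
| PresTrans u v w :
    presented_eq rels u v -> presented_eq rels v w -> presented_eq rels u w
| PresCat u u' v v' :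
    presented_eq rels u u' -> presented_eq rels v v' ->
    presented_eq rels (u ++ v) (u' ++ v')
| PresInv i b : presented_eq rels [:: (i, b); (i, ~~ b)] [::]
| PresRel r : r \in rels -> presented_eq rels r [::].

(* s induces an isomorphism from < 'I_n | rels > onto G. *)
Definition presentation s (rels : seq word) : Prop :=
  generates s /\
  forall u v, eval s u = eval s v <-> presented_eq rels u v.

End Words.

Definition finitely_presented (G : groupType) : Prop :=
  exists (n : nat) (s : 'I_n -> G) (rels : seq (word n)), presentation s rels.

(* Gromov's definition through the Gromov product.  dist is integral, so a    *)
(* rational delta is as general as a real one; the inequality forces          *)
(* 0 <= delta (take o = x = y = z).                                           *)

Definition gromov_product (T : Type) (dist : T -> T -> nat) (o x y : T) : rat :=
  ((dist o x)%:R + (dist o y)%:R - (dist x y)%:R) / 2.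

Definition gromov_hyperbolic (T : Type) (dist : T -> T -> nat) : Prop :=
  exists delta : rat, forall o x y z : T,
    Num.min (gromov_product dist o x z) (gromov_product dist o z y) - delta
      <= gromov_product dist o x y.

(* The choice of the finite generating family s is immaterial.                *)
Definition hyperbolic (G : groupType) : Prop :=
  exists (n : nat) (s : 'I_n -> G) (hs : generates s),
    gromov_hyperbolic (word_dist hs).

(* Main.v *)
Require Import Defs.
From mathcomp Require Import all_boot all_order all_algebra.
From HB Require Import structures.
From mathcomp Require Import finmap monalg boolp zify ring lra.

(* Extending scalars turns a projective resolution of Z over Z[G] into one of *)
(* Q over Q[G], so cd_Q G <= 3.  If cd_Q G <= 2, then every finitely          *)
(* presented subgroup H of G is hyperbolic, for the following reason.         *)
(*                                                                            *)
(* Let L -> C1 -> C0 -> Q be the cellular complex of a finite presentation    *)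
(* of G.  Since G is hyperbolic, a 1-cycle bounds a 2-chain of no larger l1   *)
(* norm; comparing the complex with a resolution of length 2 gives a          *)
(* Q[G]-linear E : L -> L that sends every 2-chain to one with the same       *)
(* boundary and vanishes on 2-cycles, so that |E c| <= K |bd c|.  As Q[G] is  *)
(* free over Q[H], the complexes of H and G are homotopy equivalent over      *)
(* Q[H]; transporting E through the equivalence gives an endomorphism of the  *)
(* 2-chains of H with the same properties.                                    *)
(*                                                                            *)
(* Such an E makes H hyperbolic.  Being Q[H]-linear, it almost commutes with  *)
(* multiplication by w(g) = kappa^(-4 d(g, p)) when kappa is close to 1, so   *)
(* the linear bound persists in the norm weighted by w.  Pairing the boundary *)
(* of a filling with w times the differential of d(x, .) shows that the total *)
(* weight of a geodesic issued from x is at most twice that of any path with  *)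
(* the same ends.  For p on the geodesic this forces the other path to pass   *)
(* near p, that is, triangles are slim.                                       *)

(** By [has_projective_resolution_rat] the rational dimension is at most 3. Were it at most 2,
    [finitely_presented_subgroup_hyperbolic] would contradict the existence of the given subgroup.

    The bridge between algebra and geometry is a linear isoperimetric inequality realised by an
    equivariant map: an endomorphism [E] of the 2-chains that preserves boundaries and satisfies |E
    c| <= K |bd2 c|. [bounded_section] builds it for G: a resolution that vanishes in degree 3 makes
    [E] kill cycles, and [hyperbolic_fill] then allows [c] to be replaced by an efficient filling.
    [subgroup_bounded_section] carries [E] over to H. Finite presentation of H enters there, because
    linear maps out of finitely generated free modules are bounded.

    The way back rests on equivariance: [E] nearly commutes with slowly varying weights
    ([weigh_commutator]), so the inequality can be concentrated around a point p ([slow_pairing]). A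
    geodesic is calibrated by the distance from its origin, so its weight is dominated by that of
    any competing path ([geodesic_path_weight]). A path far from p has exponentially small weight,
    whence slim triangles ([slim_of_path_weight]) and the four-point inequality
    ([hyperbolic_of_slim]). *)

Set Implicit Arguments.
Unset Strict Implicit.
Unset Printing Implicit Defensive.

Import Order.TTheory GRing.Theory Num.Theory.

Local Open Scope ring_scope.

(** * Chains over a group ring and their weighted l1 norms *)

(* Both constants are locked because conversion otherwise unfolds finitely    *)
(* supported functions and matrices.                                         *)
HB.lock Definition mono (R : nzRingType) (G : groupType) (q : R) (g : G) :
  group_ring R G := << q *g g >>.

HB.lock Definition rmono (R : nzRingType) (G : groupType) n (q : R) (g : G)
  (i : 'I_n) : 'rV[group_ring R G]_n := mono q g *: delta_mx 0 i.

Section Monomials.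
Variables (R : nzRingType) (G : groupType).
Local Notation S := (group_ring R G).
Implicit Types (a b : S) (q r : R) (g h : G).

Lemma mono1 : mono 1 1%g = 1 :> S. Proof. by rewrite mono.unlock. Qed.

Lemma monoM q r g h : mono q g * mono r h = mono (q * r) (g * h)%g.
Proof. rewrite mono.unlock; exact: gr_mulUU. Qed.

Lemma mono0 g : mono 0 g = 0 :> S.
Proof. rewrite mono.unlock; exact: monalgU0. Qed.

Lemma monoD q r g : mono (q + r) g = mono q g + mono r g.
Proof. rewrite mono.unlock; exact: monalgUD. Qed.

Lemma monoN q g : mono (- q) g = - mono q g.
Proof. rewrite mono.unlock; exact: monalgUN. Qed.

Lemma monoMn q g n : mono q g *+ n = mono (q *+ n) g.
Proof. by elim: n => [|n IH]; rewrite ?mulr0n ?mono0 // !mulrS IH monoD. Qed.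

Lemma mono_sum a : a = \sum_(g <- msupp a) mono a@_g g.
Proof. rewrite mono.unlock; exact: monalgE. Qed.

Lemma mcoeff_mono q g h : (mono q g)@_h = q *+ (g == h).
Proof. by rewrite mono.unlock mcoeffU. Qed.

Lemma mono_ind (P : S -> Prop) :
  P 0 -> (forall a b, P a -> P b -> P (a + b)) -> (forall q g, P (mono q g)) ->
  forall a, P a.
Proof.
by move=> P0 PD PU a; rewrite [a]mono_sum; apply: big_ind => // g _; apply: PU.
Qed.

Lemma augmentation_mono q g : augmentation (mono q g) = q.
Proof. rewrite mono.unlock; exact: augmentationU. Qed.

Variable n : nat.
Implicit Types (c : 'rV[S]_n) (i : 'I_n).

Lemma rmonoZ q r g h i : mono q g *: rmono r h i = rmono (q * r) (g * h)%g i.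
Proof. by rewrite rmono.unlock scalerA monoM. Qed.

Lemma rmonoD q r g i : rmono (q + r) g i = rmono q g i + rmono r g i.
Proof. by rewrite rmono.unlock monoD scalerDl. Qed.

Lemma rmonoN q g i : rmono (- q) g i = - rmono q g i.
Proof. by rewrite rmono.unlock monoN scaleNr. Qed.

Lemma rmono0 g i : rmono 0 g i = 0 :> 'rV[S]_n.
Proof. by rewrite rmono.unlock mono0 scale0r. Qed.

Lemma rmonoMn q g i k : rmono q g i *+ k = rmono (q *+ k) g i.
Proof. by elim: k => [|k IH]; rewrite ?mulr0n ?rmono0 // !mulrS IH rmonoD. Qed.

Lemma rmonoE q g i j : rmono q g i 0 j = mono q g *+ (j == i).
Proof.
by rewrite rmono.unlock !mxE eqxx eq_sym; case: eqP => _; rewrite ?mulr1 ?mulr0.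
Qed.

Lemma rmono_sum c : c = \sum_i \sum_(g <- msupp (c 0 i)) rmono (c 0 i)@_g g i.
Proof.
rewrite [LHS]row_sum_delta; apply: eq_bigr => i _.
by rewrite rmono.unlock [X in X *: _]mono_sum scaler_suml.
Qed.

Lemma rmono_ind (P : 'rV[S]_n -> Prop) :
  P 0 -> (forall x y, P x -> P y -> P (x + y)) ->
  (forall q g i, P (rmono q g i)) -> forall c, P c.
Proof.
move=> P0 PD PU c; rewrite [c]rmono_sum; apply: big_ind => // i _.
by apply: big_ind => // g _; apply: PU.
Qed.

End Monomials.

Section Extension.
Variables (R : nzRingType) (G : groupType) (V : zmodType).

Section Element.
Variable F : R -> G -> V.
Hypothesis FD : forall q r g, F (q + r) g = F q g + F r g.

(** Additivity in the scalar is all that is asked of [F], so that weights, pairings and changes of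
    rings, which are not linear over the group ring, are covered. *)
Definition gext (a : group_ring R G) : V := \sum_(g <- msupp a) F a@_g g.

Lemma gext0F g : F 0 g = 0.
Proof. by apply: (addrI (F 0 g)); rewrite -FD !addr0. Qed.

Lemma gextw (A : {fset G}) a : (msupp a `<=` A)%fset ->
  gext a = \sum_(g <- A) F a@_g g.
Proof.
by move=> aA; apply: big_fset_incl => // g _ /mcoeff_outdom ->; rewrite gext0F.
Qed.

Lemma gext_mono q g : gext (mono q g) = F q g.
Proof. by rewrite mono.unlock (gextw msuppU_le) big_seq_fset1 mcoeffUU. Qed.

Lemma gextD : {morph gext : a b / a + b}.
Proof.
move=> a b; pose A := (msupp a `|` msupp b)%fset.
rewrite !(@gextw A) ?fsubsetUl ?fsubsetUr ?msuppD_le // -big_split.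
by apply: eq_bigr => g _; rewrite mcoeffD FD.
Qed.

End Element.

Variables (n : nat) (F : R -> G -> 'I_n -> V).
Hypothesis FD : forall q r g i, F (q + r) g i = F q g i + F r g i.

Definition rext (c : 'rV[group_ring R G]_n) : V :=
  \sum_i gext (fun q g => F q g i) (c 0 i).

Lemma rext_mono q g i : rext (rmono q g i) = F q g i.
Proof.
rewrite /rext (bigD1 i) //= [X in _ + X]big1 ?addr0 => [|j ji].
  by rewrite rmonoE eqxx mulr1n gext_mono.
by rewrite rmonoE (negPf ji) mulr0n /gext msupp0 big_seq_fset0.
Qed.

Lemma rextD : {morph rext : a b / a + b}.
Proof.
move=> a b; rewrite -big_split; apply: eq_bigr => i _ /=.
by rewrite mxE gextD.
Qed.

End Extension.

Lemma morph_add0 (U V : zmodType) (T : U -> V) :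
  {morph T : x y / x + y} -> T 0 = 0.
Proof. by move=> TD; apply: (addrI (T 0)); rewrite -TD !addr0. Qed.

Lemma morph_add_sum (U V : zmodType) (T : U -> V) (I : Type) (r : seq I)
    (F : I -> U) :
  {morph T : x y / x + y} -> T (\sum_(i <- r) F i) = \sum_(i <- r) T (F i).
Proof. by move=> TD; apply: (big_morph T TD (morph_add0 TD)). Qed.

Lemma morph_rmono_eq (R : nzRingType) (G : groupType) n (V : zmodType)
    (T U : 'rV[group_ring R G]_n -> V) :
  {morph T : x y / x + y} -> {morph U : x y / x + y} ->
  (forall q g i, T (rmono q g i) = U (rmono q g i)) -> T =1 U.
Proof.
move=> TD UD TU; apply: rmono_ind => [|a b Ta Tb|//].
  by rewrite !morph_add0.
by rewrite TD UD Ta Tb.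
Qed.

Section Norm.
Variable G : groupType.
Local Notation S := (group_ring rat G).
Implicit Types (w : G -> rat) (a b : S).

Definition subadditive (V : zmodType) (nu : V -> rat) :=
  nu 0 = 0 /\ forall x y, nu (x + y) <= nu x + nu y.

Lemma subadditive_sum (V : zmodType) (nu : V -> rat) (I : Type) (r : seq I)
    (P : pred I) (F : I -> V) : subadditive nu ->
  nu (\sum_(i <- r | P i) F i) <= \sum_(i <- r | P i) nu (F i).
Proof.
move=> [nu0 nuD]; apply: (big_ind2 (fun x y => nu x <= y)) => //.
- by rewrite nu0.
- by move=> x1 x2 y1 y2 h1 h2; apply: le_trans (nuD _ _) (lerD h1 h2).
Qed.

Definition gnorm w a : rat := \sum_(g <- msupp a) w g * `|a@_g|.

Lemma gnormw w (A : {fset G}) a : (msupp a `<=` A)%fset ->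
  gnorm w a = \sum_(g <- A) w g * `|a@_g|.
Proof.
by move=> sA; apply: big_fset_incl => // g _ /mcoeff_outdom ->;
  rewrite normr0 mulr0.
Qed.

Lemma gnorm_mono w q g : gnorm w (mono q g) = w g * `|q|.
Proof. by rewrite mono.unlock (gnormw _ msuppU_le) big_seq_fset1 mcoeffUU. Qed.

Lemma gnorm0 w : gnorm w 0 = 0.
Proof. by rewrite /gnorm msupp0 big_seq_fset0. Qed.

Lemma gnorm_subadditive w : (forall g, 0 <= w g) -> subadditive (gnorm w).
Proof.
move=> w0; split=> [|a b]; first exact: gnorm0.
pose A := (msupp a `|` msupp b)%fset.
rewrite !(@gnormw w A) ?fsubsetUl ?fsubsetUr ?msuppD_le // -big_split.
by apply: ler_sum => g _; rewrite /= mcoeffD -mulrDr ler_wpM2l ?ler_normD.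
Qed.

Variable n : nat.
Implicit Types (c : 'rV[S]_n).

Definition rnorm w c : rat := \sum_i gnorm w (c 0 i).

Lemma rnorm_mono w q g i : rnorm w (rmono q g i : 'rV_n) = w g * `|q|.
Proof.
rewrite /rnorm (bigD1 i) //= [X in _ + X]big1 ?addr0 => [|j ji].
  by rewrite rmonoE eqxx gnorm_mono.
by rewrite rmonoE (negPf ji) gnorm0.
Qed.

Lemma rnorm_subadditive w : (forall g, 0 <= w g) -> subadditive (rnorm w).
Proof.
move=> w0; split=> [|a b].
  by rewrite /rnorm big1 // => i _; rewrite mxE gnorm0.
rewrite -big_split; apply: ler_sum => i _.
by rewrite mxE; apply: (gnorm_subadditive w0).2.
Qed.

Lemma rnorm_ge0 w c : (forall g, 0 <= w g) -> 0 <= rnorm w c.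
Proof.
move=> w0; apply: sumr_ge0 => i _; apply: sumr_ge0 => g _.
exact: mulr_ge0.
Qed.

Lemma rnorm_eq0 w c : (forall g, 0 < w g) -> rnorm w c = 0 -> c = 0.
Proof.
move=> w0 c0; have w0' g : 0 <= w g by apply: ltW.
have gnorm_ge0 a : 0 <= gnorm w a by apply: sumr_ge0 => g _; apply: mulr_ge0.
apply/rowP => i; rewrite mxE.
have : gnorm w (c 0 i) = 0.
  by apply: (psumr_eq0P (F := fun i => gnorm w (c 0 i)) _ c0).
move=> /eqP; rewrite /gnorm psumr_eq0 => [/allP h|g _]; last exact: mulr_ge0.
apply/malgP => g; rewrite mcoeff0; have [gs|//] := msuppP (c 0 i) g.
apply/eqP; have := h g gs; rewrite mulf_eq0 normr_eq0 gt_eqF //.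
Qed.

Lemma rnormN w c : rnorm w (- c) = rnorm w c.
Proof.
apply: eq_bigr => i _; rewrite mxE /gnorm msuppN.
by apply: eq_bigr => g _; rewrite mcoeffN normrN.
Qed.

(** It suffices to test on monomials. The predicate [A] confines the test to the support of [c], for
    maps that are controlled on only a part of the group. *)
Lemma rnorm_bound (V : zmodType) (T : 'rV[S]_n -> V) (nu : V -> rat) w K
    (A : G -> Prop) :
    {morph T : x y / x + y} -> subadditive nu ->
    (forall q g i, A g -> nu (T (rmono q g i)) <= K * (w g * `|q|)) ->
  forall c, (forall i g, g \in msupp (c 0 i) -> A g) ->
  nu (T c) <= K * rnorm w c.
Proof.
move=> TD nuS le_nu c cA.
have -> : T c = \sum_i \sum_(g <- msupp (c 0 i)) T (rmono (c 0 i)@_g g i).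
  rewrite {1}[c]rmono_sum (morph_add_sum _ _ TD); apply: eq_bigr => i _.
  exact: morph_add_sum.
apply: le_trans (subadditive_sum _ _ _ nuS) _.
rewrite mulr_sumr; apply: ler_sum => i _.
apply: le_trans (subadditive_sum _ _ _ nuS) _.
rewrite mulr_sumr big_seq [leRHS]big_seq.
by apply: ler_sum => g /cA gA; apply: le_nu.
Qed.

End Norm.

Notation one_weight := (fun=> 1 : rat).
Notation norm1 := (rnorm one_weight).

(** * Words, geodesics and Fox calculus *)

Section Word.
Variables (G : groupType) (n : nat) (s : 'I_n -> G).
Implicit Types (u v : word n) (l : 'I_n * bool) (g h : G).

Definition letter l : G := if l.2 then (s l.1)^-1%g else s l.1.

Lemma eval_nil : eval s [::] = 1%g. Proof. exact: big_nil. Qed.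

Lemma eval_cons l u : eval s (l :: u) = (letter l * eval s u)%g.
Proof. exact: big_cons. Qed.

Lemma eval_cat u v : eval s (u ++ v) = (eval s u * eval s v)%g.
Proof. exact: big_cat. Qed.

Definition inv_word u : word n := rev [seq (l.1, ~~ l.2) | l <- u].

Lemma eval_inv_word u : eval s (inv_word u) = (eval s u)^-1%g.
Proof.
elim: u => [|[i b] u IH]; first by rewrite /inv_word eval_nil invg1.
rewrite /inv_word map_cons rev_cons -cats1 eval_cat -/(inv_word u) IH.
rewrite !eval_cons eval_nil mulg1 invgM; congr (_ * _)%g.
by rewrite /letter /=; case: b; rewrite ?invgK.
Qed.

Lemma size_inv_word u : size (inv_word u) = size u.
Proof. by rewrite size_rev size_map. Qed.

Variable hs : generates s.
Local Notation wl := (word_length hs).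
Local Notation d := (word_dist hs).

Lemma word_length_word g : exists u, eval s u = g /\ size u = wl g.
Proof.
rewrite /word_length; case: ex_minnP => k /asboolP[u [ug uk]] _.
by exists u.
Qed.

Lemma word_length_eval u : (wl (eval s u) <= size u)%N.
Proof.
rewrite /word_length; case: ex_minnP => k _; apply.
by apply/asboolP; exists u.
Qed.

Lemma word_length1 : wl 1%g = 0%N.
Proof. by have := word_length_eval [::]; rewrite eval_nil leqn0 => /eqP. Qed.

Lemma word_lengthM g h : (wl (g * h)%g <= wl g + wl h)%N.
Proof.
have [u [<- <-]] := word_length_word g; have [v [<- <-]] := word_length_word h.
by rewrite -eval_cat -size_cat word_length_eval.
Qed.

Lemma word_lengthV g : wl g^-1%g = wl g.
Proof.
have le h : (wl h^-1%g <= wl h)%N.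
  have [u [<- <-]] := word_length_word h.
  by rewrite -eval_inv_word -(size_inv_word u) word_length_eval.
by apply/eqP; rewrite eqn_leq le -{1}[g]invgK le.
Qed.

Lemma word_length_letter l : (wl (letter l) <= 1)%N.
Proof.
by have := word_length_eval [:: l]; rewrite eval_cons eval_nil mulg1.
Qed.

Lemma word_dist_refl g : d g g = 0%N.
Proof. by rewrite /word_dist mulVg word_length1. Qed.

Lemma word_distC g h : d g h = d h g.
Proof. by rewrite /word_dist -word_lengthV invgM invgK. Qed.

Lemma word_dist_triangle g h k : (d g k <= d g h + d h k)%N.
Proof.
rewrite /word_dist; apply: leq_trans (word_lengthM _ _).
by rewrite -mulgA mulVKg.
Qed.

Lemma word_dist_mul g h k : d (k * g)%g (k * h)%g = d g h.
Proof. by rewrite /word_dist invgM -mulgA mulKg. Qed.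

Lemma word_distMr g h : d g (g * h)%g = wl h.
Proof. by rewrite /word_dist mulKg. Qed.

Definition geodesic u := wl (eval s u) = size u.

Lemma geodesic_cat u v : geodesic (u ++ v) -> geodesic u /\ geodesic v.
Proof.
rewrite /geodesic eval_cat size_cat => h.
have := word_lengthM (eval s u) (eval s v).
have := word_length_eval u; have := word_length_eval v.
by split; lia.
Qed.

Lemma geodesic_word g h : exists u,
  [/\ geodesic u, (g * eval s u)%g = h & size u = d g h].
Proof.
have [u [ug us]] := word_length_word (g^-1 * h)%g.
by exists u; rewrite /geodesic ug us mulVKg.
Qed.

Lemma geodesic_take u t : geodesic u -> (t <= size u)%N ->
  wl (eval s (take t u)) = t.
Proof.
move=> gu tu; have [|-> _] := @geodesic_cat (take t u) (drop t u).
  by rewrite cat_take_drop.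
by rewrite size_takel.
Qed.

Lemma geodesic_dist u i j : geodesic u -> (i <= j)%N -> (j <= size u)%N ->
  d (eval s (take i u)) (eval s (take j u)) = (j - i)%N.
Proof.
move=> gu ij ju; have tj : take j u = take i u ++ drop i (take j u).
  by rewrite -(take_takel u ij) cat_take_drop.
rewrite {1}tj eval_cat word_distMr.
have [|] := @geodesic_cat (take j u) (drop j u); first by rewrite cat_take_drop.
rewrite {1}tj => /geodesic_cat[_ ->] _.
by rewrite size_drop size_take_min (minn_idPl ju).
Qed.

End Word.

Section Fox.
Variables (R : nzRingType) (G : groupType) (n : nat) (s : 'I_n -> G).
Local Notation S := (group_ring R G).
Implicit Types (u v : word n) (l : 'I_n * bool) (g h : G).

(* The chain of the oriented edge of the Cayley graph from 1 to letter s l;   *)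
(* the edge from g to g * s i is the basis element g *: e_i.                  *)
Definition edge l : 'rV[S]_n :=
  if l.2 then rmono (- 1) (s l.1)^-1%g l.1 else rmono 1 1%g l.1.

(** The row of Fox derivatives of [u], that is, the 1-chain of the path from 1 spelled by [u] in the
    Cayley graph. *)
Fixpoint fox u : 'rV[S]_n :=
  if u is l :: u' then edge l + mono 1 (letter s l) *: fox u' else 0.

Lemma fox_cat u v : fox (u ++ v) = fox u + mono 1 (eval s u) *: fox v.
Proof.
elim: u => [|l u IH] /=; first by rewrite eval_nil mono1 scale1r add0r.
by rewrite IH eval_cons scalerDr addrA scalerA monoM mulr1.
Qed.

Definition bd1_mx : 'M[S]_(n, 1) := \matrix_(i, j) (mono 1 (s i) - 1).
Definition bd1 : 'rV[S]_n -> 'rV[S]_1 := mulmxr bd1_mx.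
HB.instance Definition _ := GRing.Linear.copy bd1 (mulmxr bd1_mx).

Lemma bd1D : {morph bd1 : x y / x + y}. Proof. exact: linearD. Qed.

Lemma bd1B : {morph bd1 : x y / x - y}. Proof. exact: linearB. Qed.

Lemma bd1Mn k : {morph bd1 : x / x *+ k}. Proof. exact: raddfMn. Qed.

Lemma bd1Z a c : bd1 (a *: c) = a *: bd1 c. Proof. exact: linearZ. Qed.

Lemma bd1_mono q g i :
  bd1 (rmono q g i) = rmono q (g * s i)%g 0 - rmono q g 0.
Proof.
rewrite /bd1 /= rmono.unlock -scalemxAl -rowE; apply/rowP => j.
by rewrite !ord1 !mxE !eqxx !mulr1 mulrBr monoM !mulr1.
Qed.

Lemma bd1_edge l : bd1 (edge l) = rmono 1 (letter s l) 0 - rmono 1 1%g 0.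
Proof.
rewrite /edge /letter; case: l => i [] /=; rewrite bd1_mono ?mul1g //.
by rewrite mulVg !rmonoN opprK addrC.
Qed.

Lemma bd1_fox u : bd1 (fox u) = rmono 1 (eval s u) 0 - rmono 1 1%g 0.
Proof.
elim: u => [|l u IH] /=; first by rewrite eval_nil linear0 subrr.
rewrite linearD linearZ /= IH bd1_edge eval_cons scalerBr !rmonoZ mulg1 !mulr1.
by rewrite addrC addrA subrK.
Qed.

Definition row_augmentation (c : 'rV[S]_1) : trivial_module R G :=
  augmentation (c 0 0).

Lemma row_augmentation_is_linear : linear row_augmentation.
Proof.
move=> a c c'; rewrite /row_augmentation !mxE augmentationD augmentationM.
by [].
Qed.

HB.instance Definition _ := GRing.isLinear.Build S 'rV[S]_1
  (trivial_module R G) _ row_augmentation row_augmentation_is_linear.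

Lemma row_augmentation_mono q g : row_augmentation (rmono q g 0) = q.
Proof. by rewrite /row_augmentation rmonoE eqxx augmentation_mono. Qed.

Lemma row_augmentation_surj x : exists c, row_augmentation c = x.
Proof. by exists (rmono x 1%g 0); rewrite row_augmentation_mono. Qed.

Lemma row_augmentation_exact : generates s -> exact_at bd1 row_augmentation.
Proof.
move=> hs c; split=> [c0|[b <-]].
  (* Modulo boundaries a 0-chain is concentrated at the vertex 1, since a path spelling [g] joins 1
     to [g]. *)
  suff [b bc] : exists b, bd1 b = c - rmono (row_augmentation c) 1%g 0.
    by exists b; rewrite [LHS]bc c0 rmono0 subr0.
  elim/rmono_ind: c {c0} => [|x y [a ax] [b b_y]|q g i].
  - by exists 0; rewrite !linear0 rmono0 subrr.
  - by exists (a + b); rewrite !linearD /= ax b_y rmonoD opprD addrACA.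
  - have [u ug] := hs g; exists (mono q 1%g *: fox u).
    rewrite linearZ /= bd1_fox ug scalerBr !rmonoZ !mul1g !mulr1 !ord1.
    by rewrite row_augmentation_mono.
change (row_augmentation (bd1 b) = 0).
elim/rmono_ind: b => [|x y hx hy|q g i].
- by rewrite !linear0.
- by rewrite !linearD /= hx hy addr0.
- by rewrite bd1_mono linearB /= !row_augmentation_mono subrr.
Qed.

End Fox.
Arguments fox R {G n} s u.
Arguments bd1 R {G n} s _.
Arguments row_augmentation R G c : clear implicits.

(** * Slowly varying weights *)

Lemma subadditive_norm : subadditive (fun x : rat => `|x|).
Proof. by split=> [|x y]; rewrite ?normr0 ?ler_normD. Qed.

Section Weight.
Variable G : groupType.
Local Notation S := (group_ring rat G).
Variable w : G -> rat.

(** Multiplication of the coefficients by [w]. It does not commute with translations, hence is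
    additive only; [weigh_commutator] measures the defect. *)
Definition weigh n : 'rV[S]_n -> 'rV[S]_n :=
  rext (fun q g i => rmono (w g * q) g i).

Lemma weighD n : {morph @weigh n : a b / a + b}.
Proof. by apply: rextD => q r g i; rewrite mulrDr rmonoD. Qed.

Lemma weigh_mono n q g i : weigh (rmono q g i : 'rV_n) = rmono (w g * q) g i.
Proof. by apply: rext_mono => {}q r {}g {}i; rewrite mulrDr rmonoD. Qed.

Lemma weighB n : {morph @weigh n : a b / a - b}.
Proof.
move=> a b; apply: (addIr (weigh b)).
by rewrite -weighD !subrK.
Qed.

Hypothesis w_gt0 : forall g, 0 < w g.

Lemma norm1_weigh n (c : 'rV[S]_n) : norm1 (weigh c) <= rnorm w c.
Proof.
rewrite -[leRHS]mul1r.
apply: (rnorm_bound (A := fun=> True)) => //; first exact: weighD.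
  exact: rnorm_subadditive.
by move=> q g i _; rewrite weigh_mono rnorm_mono !mul1r normrM gtr0_norm.
Qed.

End Weight.

Lemma rnorm_weigh (G : groupType) (w : G -> rat) n
    (c : 'rV[group_ring rat G]_n) :
  (forall g, 0 < w g) -> rnorm w c <= norm1 (weigh w c).
Proof.
move=> w0; have {1}-> : c = weigh (fun g => (w g)^-1) (weigh w c).
  apply: (@morph_rmono_eq _ _ _ _ id
    (fun c => weigh (fun g => (w g)^-1) (weigh w c))) => // [a b|q g i] /=.
    by rewrite !weighD.
  by rewrite !weigh_mono mulKf ?gt_eqF.
rewrite -[leRHS]mul1r.
apply: (rnorm_bound (A := fun=> True)) => //; first exact: weighD.
  by apply: rnorm_subadditive => g; apply: ltW.
move=> q g i _; rewrite weigh_mono rnorm_mono !mul1r normrM.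
by rewrite ger0_norm ?mulVKf ?gt_eqF // invr_ge0 ltW.
Qed.

Lemma norm1_monoZ (G : groupType) n q (g : G) (c : 'rV[group_ring rat G]_n) :
  norm1 (mono q g *: c) <= `|q| * norm1 c.
Proof.
apply: (rnorm_bound (A := fun=> True)) => //.
- exact: scalerDr.
- exact: rnorm_subadditive.
- by move=> r h i _; rewrite rmonoZ rnorm_mono !mul1r normrM.
Qed.

(** A linear map is determined by the images of finitely many basis vectors, and translations do not
    increase [nu]. The target is a general module so that restrictions to a subgroup are
    included. *)
Lemma semilinear_bounded (G : groupType) m (V : lmodType (group_ring rat G))
    (nu : V -> rat) (f : {linear 'rV[group_ring rat G]_m -> V}) :
    subadditive nu -> (forall x, 0 <= nu x) ->
    (forall q g x, nu (mono q g *: x) <= `|q| * nu x) ->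
  exists2 K, 0 <= K & forall c, nu (f c) <= K * norm1 c.
Proof.
move=> nuS nu0 nuZ; exists (\sum_i nu (f (rmono 1 1%g i))).
  exact: sumr_ge0.
move=> c; apply: (@rnorm_bound _ _ V f nu one_weight _ (fun=> True)) => //.
  exact: linearD.
move=> q g i _; rewrite mul1r -[q]mulr1 -[g]mulg1 -rmonoZ linearZ /= mulr1.
apply: le_trans (nuZ _ _ _) _; rewrite mulrC ler_wpM2r //.
by rewrite (bigD1 i) //= lerDl sumr_ge0.
Qed.

Section Linear.
Variables (G : groupType) (m n : nat).
Local Notation S := (group_ring rat G).

Lemma linear_bounded (f : {linear 'rV[S]_m -> 'rV[S]_n}) :
  exists2 K, 0 <= K & forall c, norm1 (f c) <= K * norm1 c.
Proof.
apply: semilinear_bounded => //.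
- exact: rnorm_subadditive.
- by move=> x; apply: rnorm_ge0.
- exact: norm1_monoZ.
Qed.

(** Right translates matter here: a linear map sends the basis element at [g] to [g] times a fixed
    chain, so its support lies in [g] times a finite set. *)
Definition slow (A : seq G) (eta : rat) (w : G -> rat) :=
  forall g h, h \in A -> `|w (g * h)%g - w g| <= eta * w g.

(** On a monomial at [g] the two terms differ by the factors [w (g * h) - w g], where [h] runs
    through the supports of the images of the basis. These supports form [A]; neither [A] nor [K]
    depends on the weight. *)
Lemma weigh_commutator (f : {linear 'rV[S]_m -> 'rV[S]_n}) :
  exists A : seq G, exists2 K, 0 <= K &
    forall w eta, (forall g, 0 < w g) -> 0 <= eta -> slow A eta w ->
    forall c, norm1 (weigh w (f c) - f (weigh w c)) <= eta * K * rnorm w c.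
Proof.
pose v i := f (rmono 1 1%g i).
exists (flatten [seq (msupp (v ij.1 0 ij.2) : seq G) | ij : 'I_m * 'I_n]).
have v_ge0 i : 0 <= norm1 (v i) by exact: rnorm_ge0.
exists (\sum_i norm1 (v i)); first exact: sumr_ge0.
move=> w eta w0 eta0 sl c.
apply: (rnorm_bound (A := fun=> True)
  (T := fun c => weigh w (f c) - f (weigh w c))) => //.
- by move=> a b; rewrite weighD !(linearD f) weighD opprD addrACA.
- exact: rnorm_subadditive.
move=> q g i _; rewrite weigh_mono.
have fE r : f (rmono r g i) = mono r g *: v i.
  by rewrite -linearZ rmonoZ mulr1 mulg1.
rewrite !fE.
have -> : eta * (\sum_i norm1 (v i)) * (w g * `|q|) =
          eta * w g * `|q| * (\sum_i norm1 (v i)) by ring.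
have le_v : norm1 (v i) <= \sum_i norm1 (v i).
  by rewrite (bigD1 i) //= lerDl sumr_ge0.
apply: le_trans (_ : _ <= eta * w g * `|q| * norm1 (v i)) _; last first.
  by rewrite ler_wpM2l // !mulr_ge0 // ltW.
apply: (rnorm_bound (A := fun h => h \in
    flatten [seq (msupp (v ij.1 0 ij.2) : seq G) | ij : 'I_m * 'I_n])
  (T := fun x => weigh w (mono q g *: x) - mono (w g * q) g *: x)).
- by move=> a b; rewrite !scalerDr weighD opprD addrACA.
- exact: rnorm_subadditive.
- move=> r h j hA; rewrite !rmonoZ weigh_mono -rmonoN -rmonoD rnorm_mono.
  have -> : w (g * h)%g * (q * r) + - (w g * q * r) =
            (w (g * h)%g - w g) * (q * r) by ring.
  rewrite !mul1r !normrM -[leRHS]mulrA ler_wpM2r ?mulr_ge0 //.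
  exact: sl.
- move=> j h hv; apply/flattenP; exists (msupp (v i 0 j) : seq G) => //.
  by apply/mapP; exists (i, j) => //; rewrite mem_enum.
Qed.

End Linear.

(** * Pairing chains with functions, and weights of paths *)

Section Pairing.
Variables (G : groupType) (n : nat) (s : 'I_n -> G) (f w : G -> rat).
Local Notation S := (group_ring rat G).
Local Notation bd1 := (bd1 rat s).

Definition pairing : 'rV[S]_1 -> rat := rext (fun q g _ => q * f g).

Lemma pairingD : {morph pairing : a b / a + b}.
Proof. by apply: rextD => q r g i; rewrite mulrDl. Qed.

Lemma pairing_mono q g : pairing (rmono q g 0) = q * f g.
Proof.
by rewrite /pairing rext_mono // => {}q r {}g i; rewrite mulrDl.
Qed.

Lemma pairingB : {morph pairing : a b / a - b}.
Proof. by move=> a b; apply: (addIr (pairing b)); rewrite -pairingD !subrK. Qed.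

Hypothesis f_lip : forall g i, `|f (g * s i)%g - f g| <= 1.

(** Summation by parts: pairing [f] with [bd1 c] is pairing the differential of [f] with [c], and
    this differential is at most 1 on every edge. *)
Lemma pairing_le c : `|pairing (bd1 c)| <= norm1 c.
Proof.
rewrite -[leRHS]mul1r; apply: (rnorm_bound (A := fun=> True)
  (T := fun c => pairing (bd1 c)) (nu := fun x => `|x|)) => //.
- by move=> a b; rewrite linearD pairingD.
- exact: subadditive_norm.
move=> q g i _.
rewrite bd1_mono pairingB !pairing_mono -mulrBr normrM !mul1r.
by rewrite ler_piMr.
Qed.

Hypothesis w_gt0 : forall g, 0 < w g.

(* The initial vertex of the positively oriented edge underlying the edge     *)
(* that leaves g along l.                                                     *)
Definition tail g (l : 'I_n * bool) : G :=
  if l.2 then (g * (s l.1)^-1)%g else g.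

Fixpoint path_weight g (u : word n) : rat :=
  if u is l :: u' then w (tail g l) + path_weight (g * letter s l)%g u' else 0.

Lemma mono_edge g l : mono 1 g *: edge rat s l =
  rmono (if l.2 then -1 else 1) (tail g l) l.1.
Proof.
rewrite /edge /tail; case: l => i [] /=.
  by rewrite rmonoZ mul1r.
by rewrite rmonoZ mul1r mulg1.
Qed.

Lemma path_weight_ge0 g u : 0 <= path_weight g u.
Proof. by elim: u g => [|l u IH] g //=; rewrite addr_ge0 // ltW. Qed.

Lemma path_weight_cat g u v :
  path_weight g (u ++ v) = path_weight g u + path_weight (g * eval s u)%g v.
Proof.
elim: u g => [|l u IH] g /=; first by rewrite eval_nil mulg1 add0r.
by rewrite IH eval_cons mulgA addrA.
Qed.

(** Only an inequality, since edges traversed in both directions cancel in the chain but not in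
    [path_weight]. *)
Lemma rnorm_path g u : rnorm w (mono 1 g *: fox rat s u) <= path_weight g u.
Proof.
have [w00 wD] := @rnorm_subadditive _ n w (fun g => ltW (w_gt0 g)).
elim: u g => [|l u IH] g /=; first by rewrite scaler0 w00.
rewrite scalerDr scalerA monoM mulr1; apply: le_trans (wD _ _) _.
apply: lerD (IH _); rewrite mono_edge rnorm_mono.
by case: (l.2); rewrite ?normrN normr1 mulr1.
Qed.

(** Calibration: [f] rises by exactly one along each step, so every edge contributes its full weight
    with a positive sign, whichever its orientation. *)
Lemma pairing_path a g u :
  (forall t, (t <= size u)%N -> f (g * eval s (take t u))%g = a + t%:R) ->
  pairing (bd1 (weigh w (mono 1 g *: fox rat s u))) = path_weight g u.
Proof.
elim: u g a => [|l u IH] g a fu /=.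
  rewrite scaler0 (morph_add0 (@weighD _ w n)) linear0.
  exact: morph_add0 pairingD.
rewrite scalerDr scalerA monoM mulr1 weighD bd1D pairingD.
congr (_ + _); last first.
  apply: (IH _ (a + 1)) => t tu.
  have := fu t.+1 tu; rewrite /= eval_cons mulgA => ->.
  by rewrite mulrS addrA.
have f0 : f g = a.
  by have := fu 0%N isT; rewrite take0 eval_nil mulg1 addr0.
have f1 : f (g * letter s l)%g = a + 1.
  by have := fu 1%N isT; rewrite /= take0 eval_cons eval_nil mulg1.
rewrite mono_edge weigh_mono bd1_mono pairingB !pairing_mono -mulrBr.
move: f1; rewrite /letter /tail; case: l {fu IH} => i [] /= f1.
  by rewrite mulgVK f1 f0; ring.
by rewrite f1 f0; ring.
Qed.

End Pairing.

(** * Exponential weights along geodesics *)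

(** A rational substitute for an N-th root of [1 + eta]. *)
Lemma exprn_close_to_1 N (eta : rat) : 0 < eta ->
  exists2 kappa : rat, 1 < kappa & kappa ^+ N <= 1 + eta.
Proof.
elim: N eta => [|N IH] eta eta0.
  by exists 2%:R; rewrite ?expr0 ?lerDl ?ltW.
have [|k k1 kN] := IH (eta / 2%:R); first by rewrite divr_gt0.
(* Chosen so that [x * (1 + eta / 2) = 1 + eta]. *)
pose x := 1 + (eta / 2%:R) / (1 + eta / 2%:R).
have x1 : 1 < x by rewrite ltrDl !divr_gt0 // addr_gt0 // divr_gt0.
have m1 : 1 < Num.min k x by rewrite lt_min k1 x1.
exists (Num.min k x) => //.
rewrite exprS; apply: le_trans (_ : x * k ^+ N <= _).
  have m0 : 0 <= Num.min k x by rewrite ltW // (lt_trans ltr01).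
  apply: ler_pM => //; first exact: exprn_ge0.
    by rewrite ge_min lexx orbT.
  by rewrite lerXn2r ?nnegrE ?ge_min ?lexx // ltW // (lt_trans ltr01).
apply: le_trans (_ : x * (1 + eta / 2%:R) <= _).
  by rewrite ler_wpM2l // ltW // (lt_trans ltr01).
rewrite /x mulrDl mul1r divfK ?gt_eqF ?addr_gt0 ?divr_gt0 //.
by lra.
Qed.

Lemma exprn_unbounded (kappa x : rat) : 1 < kappa -> exists N, x < kappa ^+ N.
Proof.
move=> k1; have bern N : 1 + N%:R * (kappa - 1) <= kappa ^+ N.
  elim: N => [|N IH]; first by rewrite mul0r addr0 expr0.
  rewrite exprS; apply: le_trans (ler_wpM2l _ IH); last by lra.
  rewrite -natr1; have : 0 <= N%:R * (kappa - 1) ^+ 2 :> rat.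
    by rewrite mulr_ge0 ?sqr_ge0.
  by nra.
have k0 : 0 < kappa - 1 by rewrite subr_gt0.
pose y := `|x| / (kappa - 1).
have y0 : 0 <= y by rewrite divr_ge0 // ltW.
exists (Num.bound y); apply: lt_le_trans (bern _).
have := archi_boundP y0; rewrite -(ltr_pM2r k0) divfK ?gt_eqF // => h.
by apply: le_lt_trans (ler_norm x) _; lra.
Qed.

Lemma geometric_sum_le (r : rat) (m : nat) : 0 <= r -> r < 1 ->
  \sum_(i < m) r ^+ i <= (1 - r)^-1.
Proof.
move=> r0 r1; have h : 0 < 1 - r by rewrite subr_gt0.
rewrite -[leRHS]mul1r ler_pdivlMr // mulrC -opprB mulNr -subrX1 opprB.
by rewrite gerBl exprn_ge0.
Qed.

(** With truncated subtraction the exponent is the absolute difference of [i] and [i0]. *)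
Lemma two_sided_geometric_sum_le (r : rat) (m i0 : nat) : 0 <= r -> r < 1 ->
  \sum_(i < m) r ^+ ((i - i0) + (i0 - i)) <= 2%:R * (1 - r)^-1.
Proof.
move=> r0 r1.
apply: le_trans (_ : \sum_(k < i0) r ^+ k.+1 + (1 - r)^-1 <= _); last first.
  rewrite mulr_natl mulr2n lerD2r.
  apply: le_trans (geometric_sum_le i0.+1 r0 r1).
  by rewrite big_ord_recl lerDr expr0.
have V0 : 0 <= (1 - r)^-1 by rewrite invr_ge0 subr_ge0 ltW.
elim: i0 m => [|i0 IH] [|m]; rewrite ?big_ord0 ?add0r ?addr_ge0 ?sumr_ge0 //.
- under eq_bigr do rewrite subn0 sub0n addn0.
  exact: geometric_sum_le.
- by move=> k _; rewrite exprn_ge0.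
rewrite big_ord_recl [X in _ <= X + _]big_ord_recr /= sub0n subn0 add0n.
rewrite [X in _ <= X + _]addrC -addrA lerD2l.
under eq_bigr do rewrite /bump /= add1n !subSS.
exact: IH.
Qed.

(* D i is the distance from a given point to the i-th vertex of a geodesic,   *)
(* so that 4 * D i >= 2 * R + |i - i0| where i0 minimizes D.                  *)
Lemma sum_geodesic_weight (kappa : rat) (D : nat -> nat) (m R : nat) :
    1 < kappa ->
    (forall i j, (i < m)%N -> (j < m)%N -> (i <= j)%N -> (j - i <= D i + D j)%N) ->
    (forall i, (i < m)%N -> (R <= D i)%N) ->
  \sum_(i < m) kappa ^- (4 * D i) <=
    kappa ^- (2 * R) * (2%:R * (1 - kappa^-1)^-1).
Proof.
move=> k1; have k0 : 0 < kappa by rewrite (lt_trans ltr01).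
case: m => [|m] Dd DR.
  have r1 : kappa^-1 <= 1 by rewrite invf_le1 // ltW.
  have kR : 0 <= kappa ^+ (2 * R) by rewrite exprn_ge0 // ltW.
  by rewrite big_ord0 !mulr_ge0 ?invr_ge0 ?subr_ge0.
have [i0 _ i0P] := @arg_minnP 'I_m.+1 ord0 predT (fun i => D i) isT.
pose gap i := ((i - i0) + (i0 - i))%N.
have gapD (i : 'I_m.+1) : (2 * R + gap i <= 4 * D i)%N.
  have := i0P i isT; have := DR i (ltn_ord i).
  rewrite /gap; case: (leqP i i0) => ii0.
    by have := Dd i i0 (ltn_ord i) (ltn_ord i0) ii0; lia.
  by have := Dd i0 i (ltn_ord i0) (ltn_ord i) (ltnW ii0); lia.
apply: le_trans (_ : \sum_(i < m.+1) kappa ^- (2 * R) * kappa^-1 ^+ gap i <= _).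
  apply: ler_sum => i _; rewrite exprVn -invfM -exprD lef_pV2 ?posrE ?exprn_gt0 //.
  by rewrite ler_weXn2l // ltW.
rewrite -mulr_sumr ler_wpM2l ?invr_ge0 ?exprn_ge0 // ?(ltW k0) //.
have r0 : 0 <= kappa^-1 by rewrite invr_ge0 ltW.
have r1 : kappa^-1 < 1 by rewrite invf_lt1.
exact: two_sided_geometric_sum_le.
Qed.

Lemma natr_dist_le1 (a b : nat) :
  (a <= b + 1)%N -> (b <= a + 1)%N -> `|a%:R - b%:R| <= 1 :> rat.
Proof.
rewrite -!(ler_nat rat) !natrD ler_norml => ab ba.
by apply/andP; split; lra.
Qed.

Section WordMetric.
Variables (G : groupType) (n : nat) (s : 'I_n -> G) (hs : generates s).
Local Notation d := (word_dist hs).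
Local Notation wl := (word_length hs).

(** The factor 4 is spent in two halves: one gives decay in the distance from [p] to a whole
    geodesic, the other makes the sum along that geodesic converge. *)
Definition exp_weight (kappa : rat) p g : rat := kappa ^- (4 * d g p).

Lemma exp_weight_gt0 kappa p g : 1 < kappa -> 0 < exp_weight kappa p g.
Proof. by move=> k1; rewrite invr_gt0 exprn_gt0 // (lt_trans ltr01). Qed.

Lemma exp_weight_le kappa p g h L : 1 < kappa -> (d g h <= L)%N ->
  exp_weight kappa p g <= kappa ^+ (4 * L) * exp_weight kappa p h.
Proof.
move=> k1 ghL; have k0 : 0 < kappa by rewrite (lt_trans ltr01).
rewrite /exp_weight ler_pdivlMr ?exprn_gt0 // mulrC ler_pdivrMr ?exprn_gt0 //.
rewrite -exprD ler_weXn2l // ?(ltW k1) //.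
by have := word_dist_triangle hs h g p; rewrite (word_distC hs h g); lia.
Qed.

(** Translation by an element of [A] changes the weight by a factor of at most [kappa ^+ (4 * L)].
    The same [kappa] serves all centres [p], which makes the later constants uniform. *)
Lemma exp_weight_slow (A : seq G) (eta : rat) : 0 < eta ->
  exists2 kappa, 1 < kappa & forall p, slow A eta (exp_weight kappa p).
Proof.
move=> eta0; pose L := \max_(h <- A) wl h.
have [k k1 kL] := exprn_close_to_1 (4 * L) eta0.
exists k => // p g h hA.
have hL : (wl h <= L)%N by rewrite /L; apply: leq_bigmax_seq.
have h1 : exp_weight k p g <= k ^+ (4 * L) * exp_weight k p (g * h)%g.
  by apply: exp_weight_le => //; rewrite word_distMr.
have h2 : exp_weight k p (g * h)%g <= k ^+ (4 * L) * exp_weight k p g.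
  by apply: exp_weight_le => //; rewrite word_distC word_distMr.
have y0 := exp_weight_gt0 p (g * h)%g k1.
have x0 := exp_weight_gt0 p g k1.
move: h1 h2 x0 y0 kL; move: (exp_weight k p g) (exp_weight k p (g * h)%g).
move: (k ^+ _) => z x y h1 h2 x0 y0 zL.
rewrite ler_norml; apply/andP; split; last by nra.
have : x - y <= (z - 1) * x; last by nra.
have z1 : 1 <= z.
  rewrite leNgt; apply/negP => z1.
  have zx : z * x < x by rewrite gtr_pMl.
  have zy : z * y < y by rewrite gtr_pMl.
  by lra.
have [xy|xy] := leP x y; first by nra.
have : (z - 1) * y <= (z - 1) * x by nra.
by nra.
Qed.

End WordMetric.

(** * From an equivariant bounded section to path weights *)

Section BoundedSection.
Variables (G : groupType) (n : nat) (s : 'I_n -> G) (hs : generates s).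
Local Notation S := (group_ring rat G).
Local Notation bd1 := (bd1 rat s).
Local Notation d := (word_dist hs).
Local Notation wl := (word_length hs).
Variables (m : nat) (bd2 : {linear 'rV[S]_m -> 'rV[S]_n}).
Variables (E : {linear 'rV[S]_m -> 'rV[S]_m}) (K : rat).
Hypothesis K0 : 0 <= K.
Hypothesis bd12 : forall c, bd1 (bd2 c) = 0.
Hypothesis bd2_surj : forall b, bd1 b = 0 -> exists c, bd2 c = b.
Hypothesis bd2E : forall c, bd2 (E c) = bd2 c.
Hypothesis E_le : forall c, norm1 (E c) <= K * norm1 (bd2 c).

(** [E c - c] is a cycle, and the bound [E_le] makes [E] vanish on cycles. *)
Lemma section_idem c : E (E c) = E c.
Proof.
apply/eqP; rewrite -subr_eq0 -linearB; apply/eqP.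
apply: (@rnorm_eq0 _ _ one_weight) => //; apply/eqP; rewrite eq_le.
rewrite rnorm_ge0 // andbT; apply: le_trans (E_le _) _.
rewrite linearB /= bd2E subrr.
by rewrite (@rnorm_subadditive _ _ one_weight _).1 ?mulr0.
Qed.

(* Multiplication by a slowly varying weight almost commutes with E and bd2.  *)
(* Hence the bound on E persists in the weighted norm, and since the pairing  *)
(* with f kills bd1 \o bd2 only a commutator contributes to the left side.    *)
Lemma slow_pairing eta : 0 < eta ->
  exists A, exists2 eta', 0 < eta' & forall w f,
    (forall g, 0 < w g) -> slow A eta' w ->
    (forall g i, `|f (g * s i)%g - f g| <= 1) ->
    forall b, bd1 b = 0 ->
    `|pairing f (bd1 (weigh w b))| <= eta * rnorm w b.
Proof.
move=> eta0; have [A1 [K1 K1_ge0 hE]] := weigh_commutator E.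
have [A2 [K2 K2_ge0 hd]] := weigh_commutator bd2.
have KK2 := mulr_ge0 K0 K2_ge0.
have [C Cdef] : exists C, C = 1 + K1 + K * K2 by exists (1 + K1 + K * K2).
have C1 : 1 <= C by rewrite Cdef; lra.
have C0 : 0 < C by rewrite (lt_le_trans ltr01).
(* The bound 1/2 absorbs the multiples of [rnorm w c] on the right of [c_le] into its left side; the
   bound [eta / 2] gives the final estimate. *)
have [e [e0 eC1 eC2]] : exists e : rat,
    [/\ 0 < e, e * C <= 1 / 2%:R & e * C <= eta / 2%:R].
  exists (Num.min (1 / 2%:R) (eta / 2%:R) / C).
  have Cn0 : C != 0 by rewrite gt_eqF.
  split; first by rewrite divr_gt0 // lt_min !divr_gt0.
    by rewrite divfK // ge_min lexx.
  by rewrite divfK // ge_min lexx orbT.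
exists (A1 ++ A2), e => // w f w0 sl f_lip b b0.
have sl1 : slow A1 e w by move=> g h hA; apply: sl; rewrite mem_cat hA.
have sl2 : slow A2 e w by move=> g h hA; apply: sl; rewrite mem_cat hA orbT.
(* A filling fixed by [E], so that the estimate on [E] becomes one on [c] itself. *)
have [c cE cb] : exists2 c, E c = c & bd2 c = b.
  have [c cb] := bd2_surj b0.
  by exists (E c); rewrite ?section_idem ?bd2E.
have [w00 wD] := @rnorm_subadditive G m one_weight (fun=> ler01).
have [_ wD'] := @rnorm_subadditive G n one_weight (fun=> ler01).
have wW : norm1 (bd2 (weigh w c)) <= rnorm w b + e * K2 * rnorm w c.
  rewrite -[bd2 _](subrK (weigh w b)) addrC; apply: le_trans (wD' _ _) _.
  apply: lerD; first exact: norm1_weigh.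
  by rewrite -rnormN opprB -cb; apply: hd => //; apply: ltW.
have c_le : rnorm w c <= K * (rnorm w b + e * K2 * rnorm w c) +
                         e * K1 * rnorm w c.
  apply: le_trans (rnorm_weigh _ w0) _.
  rewrite -[c in weigh w c]cE -[weigh w _](subrK (E (weigh w c))).
  rewrite addrC; apply: le_trans (wD _ _) _; apply: lerD.
    by apply: le_trans (E_le _) _; apply: ler_wpM2l.
  by apply: hE => //; apply: ltW.
have c_ge0 : 0 <= rnorm w c by apply: rnorm_ge0 => g; apply: ltW.
have b_ge0 : 0 <= rnorm w b by apply: rnorm_ge0 => g; apply: ltW.
have -> : pairing f (bd1 (weigh w b)) =
          pairing f (bd1 (weigh w (bd2 c) - bd2 (weigh w c))).
  by rewrite bd1B bd12 subr0 cb.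
apply: le_trans (pairing_le f_lip _) _.
apply: le_trans (hd w e w0 (ltW e0) sl2 c) _.
have p1 : 0 <= e * rnorm w c := mulr_ge0 (ltW e0) c_ge0.
have p2 := mulr_ge0 K1_ge0 p1; have p3 := mulr_ge0 KK2 p1.
have h1 : e * C * rnorm w c <= 1 / 2%:R * rnorm w c by rewrite ler_wpM2r.
have c_le2 : rnorm w c <= 2%:R * K * rnorm w b by rewrite Cdef in h1; lra.
have q0 : 0 <= e * K2 by rewrite mulr_ge0 // ltW.
apply: le_trans (ler_wpM2l q0 c_le2) _.
have -> : e * K2 * (2%:R * K * rnorm w b) = 2%:R * (e * (K * K2)) * rnorm w b.
  by ring.
rewrite ler_wpM2r //.
have : e * (K * K2) <= e * C by rewrite ler_wpM2l ?(ltW e0) // Cdef; lra.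
by lra.
Qed.

(* Pair the loop formed by u and v with the distance from x, which increases  *)
(* by one along every edge of u and by at most one along the edges of v.      *)
Lemma geodesic_path_weight : exists2 kappa, 1 < kappa & forall x p u v,
  geodesic hs u -> eval s u = eval s v ->
  path_weight s (exp_weight hs kappa p) x u <=
    2%:R * path_weight s (exp_weight hs kappa p) x v.
Proof.
(* With weights U of [u] and V of [v], the constant 1/3 yields U - V <= (U + V) / 3, that is, U <= 2
   V. *)
have [|A [e e0 small]] := @slow_pairing (1 / 3%:R); first by rewrite divr_gt0.
have [k k1 sl] := exp_weight_slow hs A e0; exists k => // x p u v gu uv.
pose w := exp_weight hs k p; pose f g : rat := (d x g)%:R.
have w0 g : 0 < w g by apply: exp_weight_gt0.
have f_lip g i : `|f (g * s i)%g - f g| <= 1.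
  have l1 := word_length_letter hs (i, false).
  have h1 := word_dist_triangle hs x g (g * s i)%g.
  have h2 := word_dist_triangle hs x (g * s i)%g g.
  have h3 : (d g (g * s i)%g <= 1)%N by rewrite word_distMr.
  rewrite (word_distC hs (g * s i)%g g) in h2.
  have h1' : (d x (g * s i)%g <= d x g + 1)%N by lia.
  have h2' : (d x g <= d x (g * s i)%g + 1)%N by lia.
  exact: natr_dist_le1.
pose b := mono 1 x *: fox rat s u - mono 1 x *: fox rat s v.
have b0 : bd1 b = 0.
  by rewrite /b bd1B !bd1Z !bd1_fox uv subrr.
have := small w f w0 (sl p) f_lip b b0.
have b_le : rnorm w b <= path_weight s w x u + path_weight s w x v.
  apply: le_trans ((rnorm_subadditive _ (fun g => ltW (w0 g))).2 _ _) _.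
  by rewrite rnormN lerD // rnorm_path.
have v_le : `|pairing f (bd1 (weigh w (mono 1 x *: fox rat s v)))| <=
            path_weight s w x v.
  apply: le_trans (pairing_le f_lip _) _.
  by apply: le_trans (norm1_weigh w0 _) _; apply: rnorm_path.
have u_eq : pairing f (bd1 (weigh w (mono 1 x *: fox rat s u))) =
            path_weight s w x u.
  apply: (pairing_path w (a := 0)) => t tu.
  by rewrite /f word_distMr (geodesic_take gu tu) add0r.
have b_ge0 : 0 <= rnorm w b by apply: rnorm_ge0 => g; apply: ltW.
have -> : pairing f (bd1 (weigh w b)) = path_weight s w x u -
    pairing f (bd1 (weigh w (mono 1 x *: fox rat s v))).
  rewrite /b weighB bd1B pairingB; congr (_ - _); exact: u_eq.
move: v_le b_le b_ge0; rewrite -/w.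
move: (path_weight s w x u) (path_weight s w x v) (rnorm w b).
move: (pairing f _) => q U V N; rewrite !ler_norml.
by move=> /andP[v1 v2] b_le b_ge0 /andP[h1 h2]; lra.
Qed.

End BoundedSection.

(** * Slim triangles and the four-point condition *)

Section PathWeight.
Variables (G : groupType) (n : nat) (s : 'I_n -> G) (hs : generates s).
Local Notation d := (word_dist hs).
Variables (kappa : rat) (p : G).
Hypothesis k1 : 1 < kappa.
Local Notation w := (exp_weight hs kappa p).

Lemma dist_tail g l : (d (tail s g l) g <= 1)%N.
Proof.
rewrite /tail; case: l => i [] /=; last by rewrite word_dist_refl.
by rewrite word_distC word_distMr; apply: (word_length_letter hs (i, true)).
Qed.

(** The factor [kappa ^+ 4] pays for the tail of an edge being up to one step away from the vertex
    at which the path stands. *)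
Lemma path_weight_le_sum g u : path_weight s w g u <=
  \sum_(j < size u) kappa ^+ 4 * w (g * eval s (take j u))%g.
Proof.
elim: u g => [|l u IH] g /=; first by rewrite big_ord0.
rewrite big_ord_recl /= eval_nil mulg1; apply: lerD.
  by have := exp_weight_le p k1 (dist_tail g l); rewrite muln1.
apply: le_trans (IH _) _; apply: ler_sum => j _.
by rewrite eval_cons mulgA.
Qed.

Lemma far_path_weight g u R : geodesic hs u ->
    (forall r, (r <= size u)%N -> (R <= d p (g * eval s (take r u))%g)%N) ->
  path_weight s w g u <=
    kappa ^+ 4 * (kappa ^- (2 * R) * (2%:R * (1 - kappa^-1)^-1)).
Proof.
move=> gu far; apply: le_trans (path_weight_le_sum _ _) _.
rewrite -mulr_sumr ler_wpM2l ?exprn_ge0 ?(le_trans ler01 (ltW k1)) //.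
pose D j := d (g * eval s (take j u))%g p.
apply: (@sum_geodesic_weight kappa D) => // [i j _ ju ij|i iu].
  rewrite -(geodesic_dist gu ij (ltnW ju)) -(word_dist_mul hs _ _ g).
  apply: leq_trans (word_dist_triangle hs _ p _) _.
  by rewrite /D leq_add2l word_distC.
by rewrite /D word_distC; apply: far; apply: ltnW.
Qed.

(** The strict bound on [t] provides an edge leaving [p]; its tail is within distance 1 of [p], and
    this edge alone has the required weight. *)
Lemma near_path_weight g u t : (t < size u)%N ->
  p = (g * eval s (take t u))%g -> kappa ^- 4 <= path_weight s w g u.
Proof.
move=> tu pE; have k0 : 0 < kappa by rewrite (lt_trans ltr01).
have w0 h : 0 < w h by apply: exp_weight_gt0.
rewrite -[u](cat_take_drop t) path_weight_cat -pE.
case def_v: (drop t u) => [|l v] /=.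
  by move: (size_drop t u); rewrite def_v /=; lia.
have h1 : kappa ^- 4 <= w (tail s p l).
  rewrite -div1r ler_pdivrMr ?exprn_gt0 // mulrC.
  have := exp_weight_le (hs := hs) (L := 1) p k1 (g := p) (h := tail s p l).
  rewrite muln1 {1}/exp_weight word_dist_refl muln0 expr0 invr1; apply.
  by rewrite word_distC dist_tail.
have := path_weight_ge0 s w0 g (take t u).
have := path_weight_ge0 s w0 (p * letter s l)%g v.
by lra.
Qed.

End PathWeight.

Section Slim.
Variables (G : groupType) (n : nat) (s : 'I_n -> G) (hs : generates s).
Local Notation d := (word_dist hs).

Definition between x y q := (d x q + d q y)%N = d x y.

(** Sides are replaced by the relation [between]: [p] lies on an arbitrary geodesic from [x] to [y],
    while [q] need only lie on some geodesic to or from [z]. *)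
Definition slim_triangles R := forall x y z p, between x y p ->
  exists2 q, between x z q \/ between z y q & (d p q <= R)%N.

Lemma slim_of_path_weight kappa : 1 < kappa ->
    (forall x p u v, geodesic hs u -> eval s u = eval s v ->
      path_weight s (exp_weight hs kappa p) x u <=
        2%:R * path_weight s (exp_weight hs kappa p) x v) ->
  exists R, slim_triangles R.
Proof.
move=> k1 hw; have k0 : 0 < kappa by rewrite (lt_trans ltr01).
have [C Cdef] : exists C, C = 2%:R * (1 - kappa^-1)^-1 by eexists.
have C0 : 0 <= C.
  by rewrite Cdef mulr_ge0 // invr_ge0 subr_ge0 invf_le1 // ltW.
(* If both other sides stay at distance [R] from [p], their weights and [near] give [kappa ^- 4 <= 2
   * (2 * kappa ^+ 4 * kappa ^- (2 * R) * C)], which this choice of [R] excludes. *)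
have [R hR] := exprn_unbounded (4%:R * kappa ^+ 8 * C) k1.
exists R => x y z p pxy.
have [u1 [g1 e1 s1]] := geodesic_word hs x p.
have [u2 [g2 e2 s2]] := geodesic_word hs p y.
have [v1 [gv1 ev1 sv1]] := geodesic_word hs x z.
have [v2 [gv2 ev2 sv2]] := geodesic_word hs z y.
have gu : geodesic hs (u1 ++ u2).
  rewrite /geodesic size_cat s1 s2 pxy eval_cat -(word_distMr hs x).
  by rewrite mulgA e1 e2.
have [//|far] :=
  pselect (exists2 q, between x z q \/ between z y q & (d p q <= R)%N).
exfalso.
have far' q : between x z q \/ between z y q -> (R <= d p q)%N.
  move=> bq; rewrite leqNgt; apply/negP => h; apply: far.
  by exists q; rewrite // ltnW.
have take_between g v r : geodesic hs v -> (r <= size v)%N ->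
    between g (g * eval s v)%g (g * eval s (take r v))%g.
  move=> gv rv; rewrite /between !word_distMr (geodesic_take gv rv) word_dist_mul.
  have := geodesic_dist gv rv (leqnn _); rewrite take_size => ->.
  by rewrite gv subnKC.
(* An edge must leave [p]; if [p = y], then [y] itself is the point near [p]. *)
have u2n : (0 < size u2)%N.
  rewrite lt0n s2; apply/eqP => py; apply: far; exists y.
    by right; rewrite /between word_dist_refl addn0.
  by rewrite py.
have near : kappa ^- 4 <=
    path_weight s (exp_weight hs kappa p) x (u1 ++ u2).
  apply: (@near_path_weight _ _ _ hs _ _ k1 _ _ (size u1)).
    by rewrite size_cat -addn1 leq_add2l.
  by rewrite take_size_cat // e1.
have uv : eval s (u1 ++ u2) = eval s (v1 ++ v2).
  rewrite !eval_cat; apply: (@mulgI _ x).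
  by rewrite !mulgA e1 e2 ev1 ev2.
have := hw x p _ _ gu uv.
have f1 : path_weight s (exp_weight hs kappa p) x v1 <=
    kappa ^+ 4 * (kappa ^- (2 * R) * C).
  rewrite Cdef; apply: far_path_weight => // r rv.
  by apply: far'; left; rewrite -ev1; apply: take_between.
have f2 : path_weight s (exp_weight hs kappa p) z v2 <=
    kappa ^+ 4 * (kappa ^- (2 * R) * C).
  rewrite Cdef; apply: far_path_weight => // r rv.
  by apply: far'; right; rewrite -ev2; apply: take_between.
rewrite (path_weight_cat _ _ _ v1) ev1 => h.
have : kappa ^- 4 <= 4%:R * (kappa ^+ 4 * (kappa ^- (2 * R) * C)).
  move: near h f1 f2.
  move: (path_weight s _ x (u1 ++ u2)) (path_weight s _ x v1) => a b.
  move: (path_weight s _ z v2) (kappa ^+ 4 * _) => c e.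
  by lra.
rewrite -div1r ler_pdivrMr ?exprn_gt0 //.
have -> : 4%:R * (kappa ^+ 4 * (kappa ^- (2 * R) * C)) * kappa ^+ 4 =
  4%:R * kappa ^+ 8 * C / kappa ^+ (2 * R).
  by rewrite (exprD kappa 4 4); ring.
rewrite ler_pdivlMr ?exprn_gt0 // mul1r leNgt => /negP; apply.
apply: lt_le_trans hR _.
by rewrite ler_weXn2l ?(ltW k1) //; lia.
Qed.

(** The Gromov product of [a] and [b] at [o] is at most the distance from [o] to any point between
    them. Some [p] between [x] and [y] attains it up to [2 * R + 1], and slimness moves [p] by at
    most [R] onto another side. *)
Lemma hyperbolic_of_slim R : slim_triangles R -> gromov_hyperbolic d.
Proof.
move=> slim; exists (3 * R + 1)%:R => o x y z.
have tri := word_dist_triangle hs; have sym := word_distC hs.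
have gp_le a b q : between a b q ->
    (d o a + d o b <= 2 * d o q + d a b)%N.
  rewrite /between => h; have := tri o q a; have := tri o q b.
  by rewrite (sym q a); lia.
suff [p pxy ph] : exists2 p, between x y p &
    (2 * d o p + d x y <= d o x + d o y + 4 * R + 2)%N.
  have [q [qb|qb] pq] := slim x y z p pxy; have := gp_le _ _ _ qb;
    have opq := tri o p q => qh.
  - have H : (d o x + d o z + d x y <= d o x + d o y + d x z + 2 * (3 * R + 1))%N.
      lia.
    rewrite lerBlDr ge_min; apply/orP; left.
    rewrite /gromov_product ler_pdivrMr // mulrDl divfK //.
    by move: H; rewrite -(ler_nat rat) !natrD ?natrM ?natrD; lra.
  - have H : (d o z + d o y + d x y <= d o x + d o y + d z y + 2 * (3 * R + 1))%N.
      lia.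
    rewrite lerBlDr ge_min; apply/orP; right.
    rewrite /gromov_product ler_pdivrMr // mulrDl divfK //.
    by move: H; rewrite -(ler_nat rat) !natrD ?natrM ?natrD; lra.
have [u [gu ue us]] := geodesic_word hs x y.
pose q t := (x * eval s (take t u))%g.
have qb t : (t <= size u)%N -> between x y (q t).
  move=> tu; rewrite /between /q -ue !word_distMr (geodesic_take gu tu).
  have := geodesic_dist gu tu (leqnn _); rewrite take_size word_dist_mul => ->.
  by rewrite gu subnKC.
pose near t := `[< exists2 r, between x o r & (d (q t) r <= R)%N >].
have near0 : exists t, (t <= size u)%N && near t.
  exists 0%N => /=; apply/asboolP; exists x.
    by rewrite /between word_dist_refl.
  by rewrite /q take0 eval_nil mulg1 word_dist_refl.
(* The last vertex close to the side from [x] to [o]. Its successor is close to the side from [o] to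
   [y], so this vertex is near both sides. *)
have [t /andP[tu /asboolP[r rb rR]] tmax] :=
  ex_maxnP near0 (fun t => (fun h => proj1 (andP h))).
have [r' rb' rR'] : exists2 r', between o y r' & (d (q t) r' <= R + 1)%N.
  have [tu'|tu'] := leqP (size u) t.
    exists y; first by rewrite /between word_dist_refl addn0.
    by rewrite /q take_oversize // ue word_dist_refl.
  have [r' [b|b] h] := slim x y o (q t.+1) (qb _ tu').
    suff : (t.+1 <= t)%N by rewrite ltnn.
    by apply: tmax; rewrite tu'; apply/asboolP; exists r'.
  exists r' => //; have := tri (q t) (q t.+1) r'.
  have : d (q t) (q t.+1) = 1%N.
    by rewrite /q word_dist_mul (geodesic_dist gu (leqnSn t) tu') subSnn.
  by lia.
exists (q t); first exact: qb.
move: rb rb' (qb t tu); rewrite /between => rb rb' b.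
have t1 := tri o r (q t); have t2 := tri x r (q t).
have t3 := tri o r' (q t); have t4 := tri (q t) r' y.
rewrite (sym r (q t)) in t1 t2; rewrite (sym r' (q t)) in t3.
by rewrite (sym r o) (sym x o) in rb; lia.
Qed.

End Slim.

(** * Cycles as sums of loops *)

Section Flow.
Variables (G : groupType) (n : nat) (s : 'I_n -> G).
Local Notation S := (group_ring rat G).
Local Notation bd1 := (bd1 rat s).
Local Notation fox := (fox rat s).

Definition echain (e : G * ('I_n * bool)) : 'rV[S]_n :=
  mono 1 e.1 *: edge rat s e.2.

Lemma bd1_echain e :
  bd1 (echain e) = rmono 1 (e.1 * letter s e.2)%g 0 - rmono 1 e.1 0.
Proof. by rewrite /echain bd1Z bd1_edge scalerBr !rmonoZ mulg1 mulr1. Qed.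

Lemma echain_fox g l : echain (g, l) = mono 1 g *: fox [:: l].
Proof. by rewrite /= scaler0 addr0. Qed.

Section Decomposition.
Variable Q : 'rV[S]_n -> nat -> Prop.
Hypothesis Q0 : Q 0 0%N.
Hypothesis QD : forall b m b' m', Q b m -> Q b' m' -> Q (b + b') (m + m')%N.
Hypothesis Qloop : forall g u, eval s u = 1%g -> Q (mono 1 g *: fox u) (size u).

(** Pair the boundary with the indicator of [h]: without an edge issued from [h] the value would be
    nonnegative, yet it is -1. *)
Lemma balanced_outgoing (E : seq (G * ('I_n * bool))) g h : g != h ->
  bd1 (\sum_(e <- E) echain e) = rmono 1 g 0 - rmono 1 h 0 ->
  exists2 e, e \in E & e.1 = h.
Proof.
move=> gh bE.
have [/hasP[e eE /eqP eh]|/hasPn no] := boolP (has (fun e => e.1 == h) E).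
  by exists e.
pose f k : rat := (k == h)%:R.
have : pairing f (bd1 (\sum_(e <- E) echain e)) =
       pairing f (rmono 1 g 0 - rmono 1 h 0) by rewrite bE.
rewrite pairingB !pairing_mono !mul1r /f eqxx (negPf gh) sub0r => eq1.
have : 0 <= pairing f (bd1 (\sum_(e <- E) echain e)).
  rewrite (morph_add_sum E echain (T := fun c => pairing f (bd1 c))); last first.
    by move=> a b; rewrite bd1D pairingD.
  rewrite big_seq sumr_ge0 // => e /no eh.
  by rewrite bd1_echain pairingB !pairing_mono !mul1r /f (negPf eh) subr0 ler0n.
by rewrite eq1 oppr_ge0 ler10.
Qed.

(* Extend the path u by outgoing edges until it closes up to a loop at g.     *)
Lemma flow_decomposition_aux N E g u : (size E <= N)%N ->
  bd1 (\sum_(e <- E) echain e) = rmono 1 g 0 - rmono 1 (g * eval s u)%g 0 ->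
  Q (mono 1 g *: fox u + \sum_(e <- E) echain e) (size u + size E).
Proof.
elim: N E g u => [|N IH] E g u.
  rewrite leqn0 size_eq0 => /eqP ->; rewrite big_nil addr0 addn0.
  have [gu _|gu] := eqVneq g (g * eval s u)%g.
    by apply: Qloop; apply: (@mulgI _ g); rewrite mulg1.
  move=> bE; have [] := @balanced_outgoing [::] g (g * eval s u)%g gu.
    by rewrite big_nil.
  by move=> e; rewrite in_nil.
move=> EN bE; have [gu|gu] := eqVneq g (g * eval s u)%g.
  have u1 : eval s u = 1%g by apply: (@mulgI _ g); rewrite mulg1.
  apply: QD; first exact: Qloop.
  case: E EN bE => [|[h l] E] EN; first by rewrite big_nil.
  rewrite big_cons u1 mulg1 subrr bd1D bd1_echain /= => bE.
  rewrite echain_fox -[(size E).+1]/(size [:: l] + size E)%N.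
  apply: (IH E h [:: l]) => //.
  rewrite eval_cons eval_nil mulg1.
  by move/eqP: bE; rewrite addrC addr_eq0 opprB => /eqP.
have [[h l] eE /= hg] := balanced_outgoing gu bE.
have pE := perm_to_rem eE.
have sE : (size E = (size (rem (h, l) E)).+1)%N by rewrite (perm_size pE).
rewrite (perm_big _ pE) big_cons /= sE addnS -addSn -(size_rcons u l).
rewrite addrA echain_fox.
have -> : mono 1 g *: fox u + mono 1 h *: fox [:: l] = mono 1 g *: fox (rcons u l).
  by rewrite -cats1 fox_cat [RHS]scalerDr scalerA monoM mulr1 hg.
apply: IH; first by rewrite -ltnS -sE.
move: bE; rewrite (perm_big _ pE) big_cons /= bd1D bd1_echain /= -hg.
rewrite -cats1 eval_cat eval_cons eval_nil mulg1 mulgA -hg => bE.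
apply: (addrI (rmono 1 (h * letter s l)%g 0 - rmono 1 h 0)).
by rewrite bE [RHS]addrC addrA subrK.
Qed.

Lemma flow_decomposition E : bd1 (\sum_(e <- E) echain e) = 0 ->
  Q (\sum_(e <- E) echain e) (size E).
Proof.
move=> bE; have := @flow_decomposition_aux (size E) E 1%g [::] (leqnn _).
by rewrite /= scaler0 add0r add0n; apply; rewrite bE eval_nil mulg1 subrr.
Qed.

End Decomposition.

(** Clears denominators: after scaling, [c] is a multiset of oriented edges whose cardinality
    records the norm, so combinatorial path arguments apply. *)
Definition edge_multiple (c : 'rV[S]_n) (m : rat) := exists (N : nat) E,
  [/\ (0 < N)%N, c *+ N = \sum_(e <- E) echain e & (size E)%:R = N%:R * m].

Lemma edge_multipleD c m c' m' : edge_multiple c m -> edge_multiple c' m' ->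
  edge_multiple (c + c') (m + m').
Proof.
move=> [N [E [N0 cE sE]]] [N' [E' [N0' cE' sE']]].
have reps (F : seq (G * ('I_n * bool))) k :
    \sum_(e <- flatten (nseq k F)) echain e = (\sum_(e <- F) echain e) *+ k.
  by elim: k => [|k IH]; rewrite ?big_nil //= big_cat /= IH mulrS.
have sreps (F : seq (G * ('I_n * bool))) k :
    size (flatten (nseq k F)) = (k * size F)%N.
  by elim: k => //= k IH; rewrite size_cat IH mulSn.
exists (N * N')%N, (flatten (nseq N' E) ++ flatten (nseq N E')); split.
- by rewrite muln_gt0 N0.
- by rewrite big_cat /= !reps -cE -cE' mulrnDl -!mulrnA (mulnC N').
- by rewrite size_cat !sreps natrD !natrM sE sE'; ring.
Qed.

Lemma sum_nseq_echain k e : \sum_(x <- nseq k e) echain x = echain e *+ k.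
Proof. by elim: k => [|k IH]; rewrite ?big_nil //= big_cons IH mulrS. Qed.

Lemma edge_multiple_mono q g i : edge_multiple (rmono q g i) (1 * `|q|).
Proof.
pose e := if 0 <= q then (g, (i, false)) else ((g * s i)%g, (i, true)).
have eE : echain e = rmono (Num.sg q) g i \/ q = 0.
  rewrite /e /echain /edge; have [q0|q0|->] := ltgtP q 0; last by right.
    left; rewrite rmonoZ /= mulgK mul1r ltr0_sg //.
  by left; rewrite rmonoZ /= mulg1 mul1r gtr0_sg.
have dq : (0 < `|denq q|)%N by rewrite absz_gt0 denq_neq0.
have dE : `|denq q|%N%:R = (denq q)%:~R :> rat.
  by rewrite -[in RHS]absz_denq.
have nE : `|numq q|%N%:R = `|q| * (denq q)%:~R.
  by rewrite natr_absz intr_norm numqE normrM -dE normr_nat.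
exists `|denq q|%N, (nseq `|numq q| e); split => //.
  rewrite sum_nseq_echain; case: eE => [->|q0]; last first.
    by rewrite q0 rmono0 mul0rn (_ : numq 0 = 0) // absz0 mulr0n.
  rewrite !rmonoMn; congr (rmono _ _ _).
  by rewrite -mulr_natr dE -[RHS]mulr_natr nE mulrA -numEsg.
by rewrite size_nseq nE dE mul1r mulrC.
Qed.

Lemma edge_multipleP c : edge_multiple c (norm1 c).
Proof.
have D0 : edge_multiple 0 0.
  by exists 1%N, [::]; rewrite big_nil mul0rn mulr0.
rewrite [c in edge_multiple c _]rmono_sum /rnorm.
apply: (big_ind2 edge_multiple) => // [*|i _]; first exact: edge_multipleD.
apply: (big_ind2 edge_multiple) => // [*|g _]; first exact: edge_multipleD.
exact: edge_multiple_mono.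
Qed.

(** A rational cycle is a positive multiple of a sum of loops whose lengths add up to its norm
    without loss. The second argument of [Q] tracks that length. *)
Lemma cycle_ind (Q : 'rV[S]_n -> rat -> Prop) :
    Q 0 0 -> (forall b m b' m', Q b m -> Q b' m' -> Q (b + b') (m + m')) ->
    (forall q b m, 0 < q -> Q b m -> Q (mono q 1%g *: b) (q * m)) ->
    (forall g u, eval s u = 1%g -> Q (mono 1 g *: fox u) (size u)%:R) ->
  forall b, bd1 b = 0 -> Q b (norm1 b).
Proof.
move=> Q0 QD QZ Qloop b b0; have [N [E [N0 bE sE]]] := edge_multipleP b.
have NV : 0 < (N%:R : rat)^-1 by rewrite invr_gt0 ltr0n.
have N1 : (N%:R : rat) != 0 by rewrite pnatr_eq0 -lt0n.
have NVN : (N%:R : rat)^-1 *+ N = 1 by rewrite -[LHS]mulr_natr mulVf.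
have -> : b = mono N%:R^-1 1%g *: \sum_(e <- E) echain e.
  rewrite -bE -scalerMnr scalerMnl monoMn NVN.
  by rewrite mono1 scale1r.
have -> : norm1 (mono N%:R^-1 1%g *: \sum_(e <- E) echain e) =
    N%:R^-1 * (size E)%:R.
  rewrite -bE -scalerMnr scalerMnl monoMn NVN.
  by rewrite mono1 scale1r sE mulKf.
apply: QZ => //.
apply: (@flow_decomposition (fun b m => Q b m%:R)) => //.
  by move=> b1 m1 b2 m2 h1 h2; rewrite natrD; apply: QD.
by rewrite -bE bd1Mn b0 mul0rn.
Qed.

End Flow.

(** * Filling loops by relators *)

Section Relators.
Variables (G : groupType) (n : nat) (s : 'I_n -> G).
Local Notation S := (group_ring rat G).
Local Notation bd1 := (bd1 rat s).
Local Notation fox := (fox rat s).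
Variable rels : seq (word n).

Definition bd2_mx : 'M[S]_(size rels, n) :=
  \matrix_(j < size rels) fox (tnth (in_tuple rels) j).
Definition bd2 : 'rV[S]_(size rels) -> 'rV[S]_n := mulmxr bd2_mx.
HB.instance Definition _ := GRing.Linear.copy bd2 (mulmxr bd2_mx).

Lemma bd2D : {morph bd2 : x y / x + y}. Proof. exact: linearD. Qed.

Lemma bd2N c : bd2 (- c) = - bd2 c. Proof. exact: linearN. Qed.

Lemma bd2Z a c : bd2 (a *: c) = a *: bd2 c. Proof. exact: linearZ. Qed.

Lemma bd2_mono q g j :
  bd2 (rmono q g j) = mono q g *: fox (tnth (in_tuple rels) j).
Proof.
by rewrite /bd2 /= rmono.unlock -scalemxAl -rowE rowK.
Qed.

Lemma bd1_bd2 : {in rels, forall r, eval s r = 1%g} ->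
  forall c, bd1 (bd2 c) = 0.
Proof.
move=> rels1; have b0 : bd1 0 = 0 by apply: morph_add0 (@bd1D _ _ _ s).
apply: (@morph_rmono_eq _ _ _ _ (fun c => bd1 (bd2 c)) (fun=> 0))
  => [x y|x y|q g j] /=.
- by rewrite bd2D bd1D.
- by rewrite addr0.
- by rewrite bd2_mono bd1Z bd1_fox rels1 ?mem_tnth // subrr scaler0.
Qed.

Lemma bd2_rel r : r \in rels -> exists c, bd2 c = fox r /\ norm1 c = 1.
Proof.
move=> /(tnthP (in_tuple rels))[j ->]; exists (rmono 1 1%g j).
by rewrite bd2_mono mono1 scale1r rnorm_mono normr1 mulr1.
Qed.

End Relators.
Arguments bd2 {G n} s rels _.

Section FoxInverse.
Variables (R : nzRingType) (G : groupType) (n : nat) (s : 'I_n -> G).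

Lemma fox_inv_word (u : word n) :
  fox R s (inv_word u) = - (mono 1 (eval s u)^-1%g *: fox R s u).
Proof.
have edgeV i b : edge R s (i, ~~ b) =
    - (mono 1 (letter s (i, b))^-1%g *: edge R s (i, b)).
  rewrite /edge /letter; case: b => /=; rewrite rmonoZ mul1r ?mulg1 ?rmonoN //.
  by rewrite mulVg opprK.
elim: u => [|[i b] u IH]; first by rewrite /= scaler0 oppr0.
rewrite /inv_word map_cons rev_cons -cats1 fox_cat -/(inv_word u) IH.
rewrite eval_inv_word eval_cons invgM /= scaler0 addr0 scalerDr opprD addrC.
rewrite edgeV scalerN !scalerA !monoM !mulr1.
by rewrite -mulgA mulVg mulg1.
Qed.

End FoxInverse.

Section Presentation.
Variables (G : groupType) (n : nat) (s : 'I_n -> G) (rels : seq (word n)).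
Hypothesis pres : presentation s rels.
Local Notation bd2 := (bd2 s rels).

(** Cancelling a letter against its inverse leaves the Fox chain unchanged, and deleting a relator
    changes it by a basis boundary. Concatenation uses that congruent words have equal values. *)
Lemma fox_presented_eq u v : presented_eq rels u v ->
  exists c, bd2 c = fox rat s u - fox rat s v.
Proof.
elim=> {u v} [u|u v _ [c e]|u v w _ [c e] _ [c' e']
  |u u' v v' uu' [c e] _ [c' e']|i b|r rr].
- by exists 0; rewrite (morph_add0 (@bd2D _ _ s rels)) subrr.
- by exists (- c); rewrite bd2N e opprB.
- by exists (c + c'); rewrite bd2D e e' addrA subrK.
- have uE : eval s u = eval s u' by apply/pres.2.
  exists (c + mono 1 (eval s u) *: c').
  by rewrite bd2D bd2Z e e' !fox_cat uE scalerBr opprD addrACA.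
- exists 0; rewrite (morph_add0 (@bd2D _ _ s rels)) /= scaler0 addr0 subr0.
  rewrite /edge /letter; case: b => /=; rewrite rmonoZ mul1r ?mulg1 ?mulgV.
    by rewrite -rmonoD addNr rmono0.
  by rewrite -rmonoD subrr rmono0.
- by have [c [cr _]] := bd2_rel s rr; exists c; rewrite cr subr0.
Qed.

Lemma presentation_relators : {in rels, forall r, eval s r = 1%g}.
Proof.
by move=> r rr; rewrite -(eval_nil s); apply/pres.2; apply: PresRel.
Qed.

Lemma presentation_exact b : bd1 rat s b = 0 -> exists c, bd2 c = b.
Proof.
apply: (cycle_ind (Q := fun b _ => exists c, bd2 c = b)).
- by exists 0; apply: (morph_add0 (@bd2D _ _ s rels)).
- by move=> x _ y _ [c cx] [c' cy]; exists (c + c'); rewrite bd2D cx cy.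
- by move=> q x _ _ [c cx]; exists (mono q 1%g *: c); rewrite bd2Z cx.
- move=> g u u1; have [|c cu] := @fox_presented_eq u [::].
    by apply/pres.2; rewrite u1 eval_nil.
  by exists (mono 1 g *: c); rewrite bd2Z cu subr0.
Qed.

End Presentation.

(** Both [X] and [Y] are within [j] of [p] and no farther from the base point than [p];
    hyperbolicity then bounds [dXY] by [j + 2 * delta]. *)
Lemma gromov_midpoint (delta : rat) (dX dY dp dXp dpY dXY j : nat) :
    (dXp <= j)%N -> (dpY <= j)%N -> (dX <= dp)%N -> (dY <= dp)%N ->
    2%:R * delta < j%:R ->
    Num.min ((dX%:R + dp%:R - dXp%:R) / 2%:R) ((dp%:R + dY%:R - dpY%:R) / 2%:R)
      - delta <= (dX%:R + dY%:R - dXY%:R) / 2%:R ->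
  (dXY < 2 * j)%N.
Proof.
move=> h1 h2 h3 h4 h5; rewrite lerBlDr ge_min => h6.
have {}h1 : dXp%:R <= j%:R :> rat by rewrite ler_nat.
have {}h2 : dpY%:R <= j%:R :> rat by rewrite ler_nat.
have {}h3 : dX%:R <= dp%:R :> rat by rewrite ler_nat.
have {}h4 : dY%:R <= dp%:R :> rat by rewrite ler_nat.
have : dXY%:R < 2%:R * j%:R :> rat by case/orP: h6 => h6; lra.
by rewrite -natrM ltr_nat.
Qed.

(** * The linear isoperimetric inequality of a hyperbolic group *)

Section HyperbolicFilling.
Variables (G : groupType) (n : nat) (s : 'I_n -> G) (hs : generates s).
Local Notation wl := (word_length hs).
Local Notation d := (word_dist hs).

(* Compare a vertex p of the loop at maximal distance from 1 with the two     *)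
(* vertices j steps before and after it.                                      *)
Lemma loop_shortcut : gromov_hyperbolic d -> exists2 j, (0 < j)%N &
  forall u, eval s u = 1%g -> (2 * j <= size u)%N ->
  exists x a y, [/\ u = x ++ a ++ y, size a = (2 * j)%N &
                    (wl (eval s a) < 2 * j)%N].
Proof.
move=> [delta hyp].
have [j j0 j_delta] : exists2 j, (0 < j)%N & 2%:R * delta < j%:R.
  exists (Num.bound (2%:R * `|delta|)).+1 => //.
  have h : 2%:R * delta <= 2%:R * `|delta| by rewrite ler_wpM2l // ler_norm.
  apply: le_lt_trans h _; have : 0 <= 2%:R * `|delta| by rewrite mulr_ge0.
  by move/archi_boundP => /lt_trans; apply; rewrite ltr_nat.
exists j => // u u1 ju.
pose D t := wl (eval s (take t u)).
have [i _ iD] := @arg_maxnP 'I_(size u).+1 ord0 predT (fun i => D i) isT.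
(* If the whole loop stays within [j] of 1, its initial segment of length [2 * j] already ends too
   close to its start. *)
have [Dj|Dj] := ltnP (D i) j.
  exists [::], (take (2 * j) u), (drop (2 * j) u).
  rewrite cat0s cat_take_drop size_takel //; split=> //.
  have := iD (Ordinal (ju : 2 * j < (size u).+1)%N) isT; rewrite /D /=.
  by move: Dj; rewrite /D; lia.
have iu := ltn_ord i.
have ji : (j <= i)%N.
  apply: leq_trans Dj _; rewrite /D (leq_trans (word_length_eval _ _)) //.
  by rewrite size_take_min geq_minl.
have ij : (i + j <= size u)%N.
  have : (j <= size (drop i u))%N.
    apply: leq_trans Dj _; rewrite /D.
    have : (eval s (take i u))^-1%g = eval s (drop i u).
      by apply: mulg1_eq; rewrite -eval_cat cat_take_drop.
    move/(congr1 wl); rewrite word_lengthV => ->; exact: word_length_eval.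
  by rewrite size_drop; lia.
pose a := take (2 * j) (drop (i - j) u).
have sa : size a = (2 * j)%N by rewrite size_takel // size_drop; lia.
exists (take (i - j) u), a, (drop (2 * j) (drop (i - j) u)).
split; rewrite ?cat_take_drop //.
pose X := eval s (take (i - j) u); pose p := eval s (take i u).
pose Y := eval s (take (i + j) u).
have step t k : (t + k <= size u)%N ->
    eval s (take (t + k) u) = (eval s (take t u) * eval s (take k (drop t u)))%g.
  by move=> tk; rewrite takeD eval_cat.
have XY : Y = (X * eval s a)%g.
  rewrite /Y /X -step; last by lia.
  by congr (eval s (take _ u)); lia.
have dXp : (d X p <= j)%N.
  rewrite /X /p -[in take i u](subnK ji) step; last by lia.
  rewrite word_distMr; apply: leq_trans (word_length_eval _ _) _.
  by rewrite size_take_min geq_minl.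
have dpY : (d p Y <= j)%N.
  rewrite /p /Y step; last by lia.
  rewrite word_distMr; apply: leq_trans (word_length_eval _ _) _.
  by rewrite size_take_min geq_minl.
have dXY : d X Y = wl (eval s a) by rewrite XY word_distMr.
have DX : (d 1%g X <= d 1%g p)%N.
  rewrite /word_dist invg1 !mul1g.
  have lt : (i - j < (size u).+1)%N by lia.
  exact: (iD (Ordinal lt) isT).
have DY : (d 1%g Y <= d 1%g p)%N.
  rewrite /word_dist invg1 !mul1g.
  have lt : (i + j < (size u).+1)%N by lia.
  exact: (iD (Ordinal lt) isT).
rewrite -dXY; apply: (gromov_midpoint dXp dpY DX DY j_delta).
exact: hyp 1%g X Y p.
Qed.

Definition short_loops N : seq (word n) :=
  [seq r <- flatten [seq [seq tval t | t : k.-tuple ('I_n * bool)] | k <- iota 0 N]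
     | eval s r == 1%g].

Lemma short_loopsP N r : (r \in short_loops N) = (eval s r == 1%g) && (size r < N)%N.
Proof.
rewrite mem_filter; congr (_ && _); apply/flatten_mapP/idP => [[k]|rN].
  by rewrite mem_iota => /andP[_ kN] /mapP[t _ ->]; rewrite size_tuple.
exists (size r); first by rewrite mem_iota.
by apply/mapP; exists (in_tuple r); rewrite ?mem_enum.
Qed.

Lemma short_loops_relators N : {in short_loops N, forall r, eval s r = 1%g}.
Proof. by move=> r; rewrite short_loopsP => /andP[/eqP]. Qed.

(** Dehn's algorithm: a segment of length [2 * j] is exchanged for a shorter one. The two together
    form a loop of length below [4 * j], so each exchange costs one relator and saves at least one
    letter. *)
Lemma hyperbolic_fill_loop : gromov_hyperbolic d -> exists N,
  forall u, eval s u = 1%g -> exists c,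
    bd2 s (short_loops N) c = fox rat s u /\ norm1 c <= (size u)%:R.
Proof.
move=> /loop_shortcut[j j0 short]; exists (4 * j)%N.
set rels := short_loops _; move=> u.
have [m] := ubnP (size u); elim: m u => // m IH u um u1.
have [uj|ju] := ltnP (size u) (2 * j).
  case: u um u1 uj => [|l u] um u1 uj.
    exists 0; rewrite (morph_add0 (@bd2D _ _ s rels)); split => //.
    by rewrite (@rnorm_subadditive _ _ one_weight _).1.
  have [|c [cu cn]] := @bd2_rel _ _ s rels (l :: u).
    by rewrite short_loopsP u1 eqxx /=; move: uj => /=; lia.
  by exists c; split=> //; rewrite cn ler1n.
have [x [a [y [uE sa aj]]]] := short u u1 ju.
have [a' [a'a sa']] := word_length_word hs (eval s a).
have a'lt : (size a' < 2 * j)%N by rewrite sa'.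
have [] := IH (x ++ a' ++ y).
- by move: um; rewrite uE !size_cat; lia.
- by move: u1; rewrite uE !eval_cat a'a.
move=> c [cu cn].
have [|r [rE rn]] := @bd2_rel _ _ s rels (a ++ inv_word a').
  rewrite short_loopsP eval_cat eval_inv_word a'a mulgV eqxx size_cat.
  by rewrite size_inv_word /=; lia.
exists (mono 1 (eval s x) *: r + c); split.
  rewrite bd2D bd2Z cu rE uE !fox_cat fox_inv_word a'a.
  rewrite scalerN scalerA monoM mulr1 mulgV mono1 scale1r.
  rewrite scalerBr [in LHS](scalerDr _ (fox rat s a')) [in RHS](scalerDr _ (fox rat s a)).
  rewrite addrCA; congr (_ + _).
  by rewrite addrA subrK.
have [_ nD] := @rnorm_subadditive _ (size rels) one_weight (fun g : G => ler01).
apply: le_trans (nD _ _) _.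
have rn' : norm1 (mono 1 (eval s x) *: r) <= 1.
  by apply: le_trans (norm1_monoZ _ _ _) _; rewrite normr1 mul1r rn.
apply: le_trans (lerD rn' cn) _.
by rewrite -(natrD _ 1) ler_nat uE !size_cat sa; lia.
Qed.

Lemma hyperbolic_fill : gromov_hyperbolic d -> exists N,
  forall b, bd1 rat s b = 0 -> exists c,
    bd2 s (short_loops N) c = b /\ norm1 c <= norm1 b.
Proof.
move=> /hyperbolic_fill_loop[N fill]; exists N.
set rels := short_loops N.
have nS := @rnorm_subadditive _ (size rels) one_weight (fun g : G => ler01).
apply: (cycle_ind (Q := fun b m => exists c, bd2 s rels c = b /\ norm1 c <= m)).
- by exists 0; rewrite (morph_add0 (@bd2D _ _ s rels)) nS.1.
- move=> x m y m' [c [cx cm]] [c' [cy cm']]; exists (c + c').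
  by rewrite bd2D cx cy; split=> //; apply: le_trans (nS.2 _ _) (lerD cm cm').
- move=> q x m q0 [c [cx cm]]; exists (mono q 1%g *: c).
  rewrite bd2Z cx; split=> //; apply: le_trans (norm1_monoZ _ _ _) _.
  by rewrite gtr0_norm // ler_pM2l.
- move=> g u u1; have [c [cu cm]] := fill u u1.
  exists (mono 1 g *: c); rewrite bd2Z cu; split=> //.
  by apply: le_trans (norm1_monoZ _ _ _) _; rewrite normr1 mul1r.
Qed.

End HyperbolicFilling.

(** * Projective resolutions *)

Section FreeModule.
Variables (S : nzRingType) (K : choiceType) (M : lmodType S) (l : K -> M).

Definition free_ext (c : {malg S[K]}) : M := \sum_(x <- msupp c) c@_x *: l x.

Lemma free_extw (A : {fset K}) c : (msupp c `<=` A)%fset ->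
  free_ext c = \sum_(x <- A) c@_x *: l x.
Proof.
by move=> cA; apply: big_fset_incl => // x _ /mcoeff_outdom ->; rewrite scale0r.
Qed.

Lemma free_ext_is_linear : linear free_ext.
Proof.
move=> a b c; pose A := (msupp b `|` msupp c)%fset.
have sb : (msupp b `<=` A)%fset by apply: fsubsetUl.
have sc : (msupp c `<=` A)%fset by apply: fsubsetUr.
rewrite (free_extw sb) (free_extw sc) (@free_extw A); last first.
  apply: fsubset_trans (msuppD_le _ _) _; rewrite fsubUset sc andbT.
  exact: fsubset_trans (msuppZ_le _ _) sb.
rewrite scaler_sumr -big_split; apply: eq_bigr => x _ /=.
by rewrite mcoeffD mcoeffZ scalerDl scalerA.
Qed.

HB.instance Definition _ := GRing.isLinear.Build S {malg S[K]} M _ free_ext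
  free_ext_is_linear.

Lemma free_extU a x : free_ext << a *g x >> = a *: l x.
Proof. by rewrite (free_extw msuppU_le) big_seq_fset1 mcoeffUU. Qed.

End FreeModule.

Section FreeMaps.
Variables (S : nzRingType) (K : choiceType).

Lemma malgU_scale a (x : K) : << a *g x >> = a *: (<< 1 *g x >> : {malg S[K]}).
Proof. by apply/malgP => y; rewrite mcoeffZ !mcoeffU mulrnAr mulr1. Qed.

Lemma linear_free_ext (M : lmodType S) (f : {linear {malg S[K]} -> M}) c :
  f c = free_ext (fun x => f << 1 *g x >>) c.
Proof.
rewrite {1}[c]monalgE linear_sum; apply: eq_bigr => x _.
by rewrite [in LHS]malgU_scale linearZ.
Qed.

End FreeMaps.

Section Comparison.
Variable S : nzRingType.

Lemma projective_section (P : lmodType S) : projective P ->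
  exists g : {linear P -> {malg S[P]}}, forall x, free_ext id (g x) = x.
Proof.
move=> projP.
have [x|g gE] := projP {malg S[P]} P (free_ext (id : P -> P)) idfun.
  by exists << 1 *g x >>; rewrite [LHS]free_extU scale1r.
by exists g.
Qed.

Lemma projective_of_section (P : lmodType S) (X : choiceType)
    (g : {linear P -> {malg S[X]}}) (p : {linear {malg S[X]} -> P}) :
  (forall x, p (g x) = x) -> projective P.
Proof.
move=> pg M N q f q_surj.
have [l lE] := choice (fun x : X => q_surj (f (p << 1 *g x >>))).
exists (free_ext l \o g) => x /=; rewrite -[in RHS](pg x).
rewrite [RHS](linear_free_ext (f \o p)) /free_ext linear_sum.
by apply: eq_bigr => y _; rewrite linearZ /= lE.
Qed.

(** Here [p] need not be onto. As [P] is a retract of a free module, it suffices to lift the images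
    of basis elements one at a time. *)
Lemma projective_lift (P M N : lmodType S) (p : {linear M -> N})
    (f : {linear P -> N}) : projective P -> (forall x, exists m, p m = f x) ->
  exists g : {linear P -> M}, forall x, p (g x) = f x.
Proof.
move=> /projective_section[g gE] lift.
have [l lE] := choice lift.
exists (free_ext l \o g) => x /=; rewrite -[in RHS](gE x).
rewrite /free_ext !linear_sum; apply: eq_bigr => y _.
by rewrite !linearZ /= lE.
Qed.

Lemma row_projective n : projective 'rV[S]_n.
Proof.
move=> M N p f p_surj.
have [l lE] := choice (fun i : 'I_n => p_surj (f (delta_mx 0 i))).
pose g (c : 'rV[S]_n) := \sum_i c 0 i *: l i.
have g_lin : linear g.
  move=> a b c; rewrite /g scaler_sumr -big_split; apply: eq_bigr => i _ /=.
  by rewrite !mxE scalerDl scalerA.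
pose gL := GRing.isLinear.Build S 'rV[S]_n M _ g g_lin.
pose gM : {linear 'rV[S]_n -> M} := HB.pack g gL.
exists gM => c; rewrite [in RHS](row_sum_delta c) /= /g !linear_sum.
by apply: eq_bigr => i _; rewrite !linearZ /= lE.
Qed.

(* The composites of lifts in both directions between two resolutions are     *)
(* homotopic to the identity: k0 and k1 below are the homotopies.             *)
Lemma resolution_comparison (M L C1 C0 L' C1' C0' : lmodType S)
    (d2 : {linear L -> C1}) (d1 : {linear C1 -> C0}) (e : {linear C0 -> M})
    (d2' : {linear L' -> C1'}) (d1' : {linear C1' -> C0'})
    (e' : {linear C0' -> M}) :
    projective L -> projective C1 -> projective C0 ->
    projective L' -> projective C1' -> projective C0' ->
    (forall m, exists x, e x = m) -> exact_at d1 e -> exact_at d2 d1 ->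
    (forall m, exists x, e' x = m) -> exact_at d1' e' -> exact_at d2' d1' ->
  exists (j1 : {linear C1 -> C1'}) (j2 : {linear L -> L'})
         (r2 : {linear L' -> L}) (k1 : {linear C1 -> L}),
    (forall c, d2' (j2 c) = j1 (d2 c)) /\
    (forall x c, d1 c = 0 -> d2' x = j1 c -> d2 (r2 x - k1 c) = c).
Proof.
move=> pL pC1 pC0 pL' pC1' pC0' se ee1 e12 se' ee1' e12'.
have ed c : e (d1 c) = 0 by apply/ee1; exists c.
have dd c : d1 (d2 c) = 0 by apply/e12; exists c.
have ed' c : e' (d1' c) = 0 by apply/ee1'; exists c.
have dd' c : d1' (d2' c) = 0 by apply/e12'; exists c.
have [j0 j0E] := @projective_lift _ _ _ e' e pC0 (fun x => se' (e x)).
have [|j1 j1E] := @projective_lift _ _ _ d1' (j0 \o d1) pC1.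
  by move=> x; apply/ee1'; rewrite /= j0E ed.
have [|j2 j2E] := @projective_lift _ _ _ d2' (j1 \o d2) pL.
  by move=> x; apply/e12'; rewrite /= j1E /= dd linear0.
have [r0 r0E] := @projective_lift _ _ _ e e' pC0' (fun x => se (e' x)).
have [|r1 r1E] := @projective_lift _ _ _ d1 (r0 \o d1') pC1'.
  by move=> x; apply/ee1; rewrite /= r0E ed'.
have [|r2 r2E] := @projective_lift _ _ _ d2 (r1 \o d2') pL'.
  by move=> x; apply/e12; rewrite /= r1E /= dd' linear0.
have [|k0 k0E] := @projective_lift _ _ _ d1 ((r0 \o j0) \- idfun) pC0.
  by move=> x; apply/ee1; rewrite /= linearB /= r0E j0E subrr.
have [|k1 k1E] := @projective_lift _ _ _ d2
    (((r1 \o j1) \- idfun) \- (k0 \o d1)) pC1.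
  move=> x; apply/e12; rewrite /= !linearB /= r1E /= j1E /= k0E /=.
  by rewrite subrr.
exists j1, j2, r2, k1; split=> [c|x c dc xc]; first exact: j2E.
rewrite linearB /= r2E k1E /= xc dc linear0 subr0.
by rewrite opprB addrC subrK.
Qed.

End Comparison.

(** * The equivariant bounded section of a hyperbolic group *)

Lemma bounded_section (G : groupType) (n : nat) (s : 'I_n -> G)
    (hs : generates s) :
    has_projective_resolution (trivial_module rat G) 2 ->
    gromov_hyperbolic (word_dist hs) ->
  exists (rels : seq (word n)) (E : {linear 'rV[group_ring rat G]_(size rels)
      -> 'rV[group_ring rat G]_(size rels)}) (K : rat),
    [/\ 0 <= K, exact_at (bd2 s rels) (bd1 rat s),
        forall c, bd2 s rels (E c) = bd2 s rels c
      & forall c, norm1 (E c) <= K * norm1 (bd2 s rels c)].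
Proof.
move=> [P [d [e [[projP e_surj ex0 ex] P0]]]] /hyperbolic_fill[N fill].
set rels := short_loops s N.
have ex2 : exact_at (bd2 s rels) (bd1 rat s).
  move=> b; split=> [/fill[c [cb _]]|[c <-]]; first by exists c.
  exact: (bd1_bd2 (@short_loops_relators _ _ s N)).
have [j1 [j2 [r2 [k1 [jE rE]]]]] :=
  @resolution_comparison _ (trivial_module rat G) _ _ _ _ _ _ (bd2 s rels)
   (bd1 rat s) (row_augmentation rat G) (d 1%N) (d 0%N) e
   (@row_projective _ _) (@row_projective _ _) (@row_projective _ _)
   (projP 2%N) (projP 1%N) (projP 0%N) (@row_augmentation_surj rat G)
   (row_augmentation_exact hs) ex2 e_surj ex0 (ex 0%N).
pose E : {linear 'rV[group_ring rat G]_(size rels)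
      -> 'rV[group_ring rat G]_(size rels)} := (r2 \o j2) \- (k1 \o bd2 s rels).
have E0 c : bd2 s rels c = 0 -> E c = 0.
  move=> c0; change (r2 (j2 c) - k1 (bd2 s rels c) = 0).
  rewrite c0 linear0 subr0.
  (* [j2 c] is a cycle in degree 2, hence comes from [P 3], which is zero. *)
  have := jE c; rewrite [X in j1 X]c0 linear0 => /(ex 1%N)[x <-].
  by rewrite (P0 3%N isT x) !linear0.
have [K K0 EK] := linear_bounded E.
exists rels, E, K; split=> // c.
  by apply: rE; [apply/ex2; exists c | apply: jE].
(* [E c] depends only on the boundary of [c], so [c] may be traded for a filling no larger than that
   boundary. *)
have [|c' [c'b c'n]] := fill (bd2 s rels c); first by apply/ex2; exists c.
have -> : E c = E c'.
  by apply/eqP; rewrite -subr_eq0 -linearB E0 // linearB /= c'b subrr.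
by apply: le_trans (EK c') _; apply: ler_wpM2l.
Qed.

(** * Restriction to a subgroup *)

Section Restriction.
Variables (R : nzRingType) (G : groupType) (P : pred G) (H : subGroupType P).
Local Notation SG := (group_ring R G).
Local Notation SH := (group_ring R H).

Definition gr_incl : SH -> SG := gext (fun q (h : H) => mono q (val h)).

Lemma gr_incl_mono q h : gr_incl (mono q h) = mono q (val h).
Proof. by apply: gext_mono => *; rewrite monoD. Qed.

Lemma gr_inclD : {morph gr_incl : a b / a + b}.
Proof. by apply: gextD => *; rewrite monoD. Qed.

Lemma gr_inclM : {morph gr_incl : a b / a * b}.
Proof.
move=> a b; elim/mono_ind: a => [|a a' IH IH'|q g].
- by rewrite mul0r (morph_add0 gr_inclD) mul0r.
- by rewrite mulrDl !gr_inclD IH IH' mulrDl.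
elim/mono_ind: b => [|b b' IH IH'|r h].
- by rewrite mulr0 (morph_add0 gr_inclD) mulr0.
- by rewrite mulrDr !gr_inclD IH IH' mulrDr.
- by rewrite monoM !gr_incl_mono monoM valM.
Qed.

Lemma gr_incl1 : gr_incl 1 = 1.
Proof. by rewrite -mono1 gr_incl_mono val1 mono1. Qed.

Lemma augmentation_gr_incl a : augmentation (gr_incl a) = augmentation a.
Proof.
elim/mono_ind: a => [|a b IH IH'|q h].
- by rewrite (morph_add0 gr_inclD) !augmentation0.
- by rewrite gr_inclD !augmentationD IH IH'.
- by rewrite gr_incl_mono !augmentation_mono.
Qed.

(** The argument [K] is a phantom: it keeps the subgroup in the type, so that the module structure
    over its group ring can be found. *)
Definition restr (K : subGroupType P) (W : lmodType SG) : Type := W.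
HB.instance Definition _ K W := GRing.Zmodule.on (restr K W).

Section Module.
Variable W : lmodType SG.

Definition restr_scale (a : SH) (x : restr H W) : restr H W := gr_incl a *: (x : W).

Lemma restr_scaleA a b x :
  restr_scale a (restr_scale b x) = restr_scale (a * b) x.
Proof. by rewrite /restr_scale gr_inclM scalerA. Qed.

Lemma restr_scale1 : left_id 1 restr_scale.
Proof. by move=> x; rewrite /restr_scale gr_incl1 scale1r. Qed.

Lemma restr_scaleDr : right_distributive restr_scale +%R.
Proof. by move=> a x y; rewrite /restr_scale scalerDr. Qed.

Lemma restr_scaleDl x : {morph restr_scale^~ x : a b / a + b}.
Proof. by move=> a b; rewrite /restr_scale gr_inclD scalerDl. Qed.

HB.instance Definition _ := GRing.Zmodule_isLmodule.Build SH (restr H W)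
  restr_scaleA restr_scale1 restr_scaleDr restr_scaleDl.

Lemma restr_scaleE a (x : restr H W) : a *: x = gr_incl a *: (x : W).
Proof. by []. Qed.

End Module.

Definition restr_map (W W' : lmodType SG) (f : W -> W') :
  restr H W -> restr H W' := f.

Lemma restr_map_is_linear (W W' : lmodType SG) (f : {linear W -> W'}) :
  linear (restr_map f).
Proof. by move=> a x y; rewrite /restr_map linearP. Qed.

HB.instance Definition _ (W W' : lmodType SG) (f : {linear W -> W'}) :=
  GRing.isLinear.Build SH (restr H W) (restr H W') _ (restr_map f)
    (restr_map_is_linear f).

Definition restr_augmentation : restr H 'rV[SG]_1 -> trivial_module R H :=
  row_augmentation R G.

Lemma restr_augmentation_is_linear : linear restr_augmentation.
Proof.
move=> a x y; rewrite /restr_augmentation restr_scaleE linearP.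
congr (_ + _); rewrite -[LHS]/(augmentation (gr_incl a) * _).
by rewrite augmentation_gr_incl.
Qed.

HB.instance Definition _ := GRing.isLinear.Build SH (restr H 'rV[SG]_1)
  (trivial_module R H) _ restr_augmentation restr_augmentation_is_linear.

Lemma sub_group1 : P 1%g.
Proof. by rewrite -(val1 H); apply: valP. Qed.

Lemma sub_groupMl (h : H) g : P (val h * g)%g = P g.
Proof.
apply/idP/idP => [hg|Pg].
  rewrite -(mulKg (val h) g) -(insubdK (1%g : H) hg).
  by rewrite -gmulfV -valM; apply: valP.
by rewrite -(insubdK (1%g : H) Pg) -valM; apply: valP.
Qed.

(** Canonical choice makes the representative constant on the right coset of [g]: the predicates of
    two members agree. *)
Definition coset_rep (g : G) : G := choose (fun y => P (g * y^-1)%g) g.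

Lemma coset_repP g : P (g * (coset_rep g)^-1)%g.
Proof.
by apply: (@chooseP _ (fun y => P (g * y^-1)%g)); rewrite mulgV sub_group1.
Qed.

Lemma coset_repM (h : H) g : coset_rep (val h * g)%g = coset_rep g.
Proof.
rewrite /coset_rep (eq_choose (Q := fun y => P (g * y^-1)%g)) => [|y].
  apply: choose_id; rewrite ?mulgV ?sub_group1 //.
  by rewrite -(sub_groupMl h) mulgA mulgV sub_group1.
by rewrite -mulgA sub_groupMl.
Qed.

Definition coset_part (g : G) : H := insubd 1%g (g * (coset_rep g)^-1)%g.

Lemma coset_partE g : (val (coset_part g) * coset_rep g)%g = g.
Proof. by rewrite insubdK ?mulgVK //; apply: coset_repP. Qed.

Lemma coset_partM (h : H) g : coset_part (val h * g)%g = (h * coset_part g)%g.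
Proof.
apply: val_inj; apply: (@mulIg _ (coset_rep g)).
by rewrite -{1}(coset_repM h g) coset_partE valM -mulgA coset_partE.
Qed.

Lemma restr_monoZ n q h (x : restr H 'rV[SG]_n) :
  mono q h *: x = mono q (val h) *: (x : 'rV[SG]_n).
Proof. by rewrite restr_scaleE gr_incl_mono. Qed.

Lemma restr_rmono n q g (i : 'I_n) : rmono q g i =
  mono q (coset_part g) *: (rmono 1 (coset_rep g) i : restr H 'rV[SG]_n).
Proof. by rewrite restr_monoZ rmonoZ mulr1 coset_partE. Qed.

(* R[G] is free over R[H] on the coset representatives.                       *)
Lemma restr_row_projective n : projective (restr H 'rV[SG]_n).
Proof.
move=> M N p f p_surj.
have [l lE] := choice (fun gi : G * 'I_n =>
  p_surj (f (rmono 1 gi.1 gi.2 : 'rV[SG]_n))).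
pose F q g i : M := mono q (coset_part g) *: l (coset_rep g, i).
have FD q r g i : F (q + r) g i = F q g i + F r g i.
  by rewrite /F monoD scalerDl.
pose k : restr H 'rV[SG]_n -> M := rext F.
have kD : {morph k : x y / x + y} := rextD FD.
have k_lin : linear k.
  suff kZ a x : k (a *: x) = a *: k x by move=> a x y; rewrite kD kZ.
  elim/mono_ind: a => [|a b IH IH'|q h].
  - by rewrite !scale0r (morph_add0 kD).
  - by rewrite !scalerDl kD IH IH'.
  apply: (@morph_rmono_eq _ _ _ _ (fun x => k (mono q h *: (x : restr H 'rV[SG]_n)))
    (fun x => mono q h *: k x)) => [y z|y z|r g i].
  - by rewrite scalerDr kD.
  - by rewrite kD scalerDr.
  - rewrite restr_monoZ rmonoZ /k !rext_mono // /F.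
    by rewrite coset_partM coset_repM scalerA monoM.
pose kL := GRing.isLinear.Build SH (restr H 'rV[SG]_n) M _ k k_lin.
pose kM : {linear restr H 'rV[SG]_n -> M} := HB.pack k kL.
exists kM; apply: (@morph_rmono_eq _ _ _ _ (fun x => p (k x)) f) => [x y|x y|q g i].
- by rewrite kD linearD.
- exact: (linearD f).
- rewrite /k rext_mono // /F linearZ /= lE /= -linearZ /=.
  by rewrite [in RHS]restr_rmono.
Qed.

End Restriction.
Arguments restr_map {R G P} H {W W'} f _.
Arguments restr_augmentation R {G P} H _.

Lemma mcoeff_monoM (R : nzRingType) (G : groupType) q (x y : G)
    (b : group_ring R G) :
  (mono q x * b)@_(x * y)%g = q * b@_y.
Proof.
elim/mono_ind: b => [|a b IH IH'|r z].
- by rewrite mulr0 !mcoeff0 mulr0.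
- by rewrite mulrDr !mcoeffD IH IH' mulrDr.
- by rewrite monoM !mcoeff_mono (inj_eq (@mulgI _ x)) mulrnAr.
Qed.

Lemma msupp_monoM (R : nzRingType) (G : groupType) q (x g : G)
    (b : group_ring R G) :
  g \in msupp (mono q x * b) -> (x^-1 * g)%g \in msupp b.
Proof.
rewrite -{1}(mulVKg x g) -!mcoeff_neq0 mcoeff_monoM.
by apply: contra_neq => ->; rewrite mulr0.
Qed.

Lemma ler_sum_seq_term (I : eqType) (r : seq I) (F : I -> rat) x :
  (forall y, 0 <= F y) -> x \in r -> F x <= \sum_(y <- r) F y.
Proof. by move=> F0 xr; rewrite (big_rem x) //= lerDl sumr_ge0. Qed.

Section Subgroup.
Variables (G : groupType) (P : pred G) (H : subGroupType P).
Local Notation SG := (group_ring rat G).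
Local Notation SH := (group_ring rat H).

(* f is only linear over Q[H], but the image of T meets finitely many cosets  *)
(* of H.                                                                      *)
Lemma bounded_on_image m n p (T : {linear 'rV[SH]_m -> restr H 'rV[SG]_n})
    (f : {linear restr H 'rV[SG]_n -> 'rV[SH]_p}) :
  exists2 K, 0 <= K & forall c, norm1 (f (T c)) <= K * norm1 (T c : 'rV[SG]_n).
Proof.
pose v i : 'rV[SG]_n := T (rmono 1 1%g i).
pose A := [seq coset_rep P g | g <- flatten
  [seq (msupp (v ij.1 0 ij.2) : seq G) | ij : 'I_m * 'I_n]].
have TA c j g : g \in msupp ((T c : 'rV[SG]_n) 0 j) -> coset_rep P g \in A.
  elim/rmono_ind: c => [|a b IH IH'|q h i].
  - by rewrite linear0 mxE msupp0 in_fset0.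
  - rewrite linearD mxE => gab.
    have := fsubsetP (msuppD_le _ _) g gab.
    by rewrite in_fsetU => /orP[/IH|/IH'].
  - have -> : T (rmono q h i) = mono q (val h) *: v i.
      by rewrite -restr_monoZ -linearZ /= rmonoZ mulr1 mulg1.
    rewrite mxE => /msupp_monoM gv.
    rewrite -(mulVKg (val h) g) coset_repM; apply: map_f.
    apply/flattenP; exists (msupp (v i 0 j) : seq G) => //.
    by apply/mapP; exists (i, j) => //; rewrite mem_enum.
pose F (a : G) := \sum_j norm1 (f (rmono 1 a j : 'rV[SG]_n)).
have F0 a : 0 <= F a by apply: sumr_ge0 => j _; apply: rnorm_ge0.
exists (\sum_(a <- A) F a); first by rewrite big_seq sumr_ge0.
move=> c; apply: (@rnorm_bound _ _ _ f (rnorm one_weight) one_weight _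
  (fun g => coset_rep P g \in A)) => [| |q g j gA|j g /TA //].
- by move=> x y; apply: (linearD f).
- exact: rnorm_subadditive.
rewrite (restr_rmono H) linearZ /=; apply: le_trans (norm1_monoZ _ _ _) _.
rewrite mulrC mul1r ler_wpM2r //.
apply: le_trans (ler_sum_seq_term F0 gA).
by rewrite /F (bigD1 j) //= lerDl sumr_ge0 // => *; apply: rnorm_ge0.
Qed.

(** Map a chain of [H] to [G], apply [EG], map back and correct by the homotopy.
    [resolution_comparison] accepts any filling of [j1 c], in particular one modified by [EG]. The
    return map [r2] has a source that need not be finitely generated over the subgroup ring, so
    [bounded_on_image] bounds it only on the image of [T]. *)
Lemma subgroup_bounded_section n (s : 'I_n -> G) (hs : generates s)
    k (t : 'I_k -> H) (relsH : seq (word k)) :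
    has_projective_resolution (trivial_module rat G) 2 ->
    gromov_hyperbolic (word_dist hs) -> presentation t relsH ->
  exists (E : {linear 'rV[SH]_(size relsH) -> 'rV[SH]_(size relsH)}) (K : rat),
    [/\ 0 <= K, forall c, bd2 t relsH (E c) = bd2 t relsH c
      & forall c, norm1 (E c) <= K * norm1 (bd2 t relsH c)].
Proof.
move=> pd2 hyp pres.
have [rels [EG [KG [KG0 exG EG2 EGn]]]] := bounded_section pd2 hyp.
have exH : exact_at (bd2 t relsH) (bd1 rat t).
  move=> b; split=> [/(presentation_exact pres)//|[c <-]].
  exact: (bd1_bd2 (presentation_relators pres)).
have [j1 [j2 [r2 [k1 [jE rE]]]]] :=
  @resolution_comparison _ (trivial_module rat H) _ _ _ _ _ _ (bd2 t relsH)
   (bd1 rat t) (row_augmentation rat H) (restr_map H (bd2 s rels))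
   (restr_map H (bd1 rat s)) (restr_augmentation rat H)
   (@row_projective _ _) (@row_projective _ _) (@row_projective _ _)
   (@restr_row_projective _ _ _ _ _) (@restr_row_projective _ _ _ _ _)
   (@restr_row_projective _ _ _ _ _) (@row_augmentation_surj rat H)
   (row_augmentation_exact pres.1) exH (@row_augmentation_surj rat G)
   (row_augmentation_exact hs) exG.
pose T : {linear 'rV[SH]_(size relsH) -> restr H 'rV[SG]_(size rels)} :=
  restr_map H EG \o j2.
pose E : {linear 'rV[SH]_(size relsH) -> 'rV[SH]_(size relsH)} :=
  (r2 \o T) \- (k1 \o bd2 t relsH).
have [K1 K10 hK1] := bounded_on_image T r2.
have [K2 K20 hK2] := linear_bounded k1.
have [K3 K30 hK3] : exists2 K, 0 <= K & forall c,
    norm1 (j1 c : 'rV[SG]_n) <= K * norm1 c.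
  apply: (@semilinear_bounded _ _ (restr H 'rV[SG]_n)
    (fun x => norm1 (x : 'rV[SG]_n))).
  - exact: rnorm_subadditive.
  - by move=> x; apply: rnorm_ge0.
  - by move=> q h x; rewrite restr_monoZ; apply: norm1_monoZ.
have TE c : bd2 s rels (T c) = j1 (bd2 t relsH c).
  by rewrite -[RHS]jE; apply: EG2.
exists E, (K1 * (KG * K3) + K2); split.
- by rewrite addr_ge0 ?mulr_ge0.
- move=> c; apply: (rE (T c) (bd2 t relsH c)); last exact: TE.
  by apply/exH; exists c.
move=> c; change (norm1 (r2 (T c) - k1 (bd2 t relsH c)) <=
  (K1 * (KG * K3) + K2) * norm1 (bd2 t relsH c)).
apply: le_trans ((rnorm_subadditive _ _).2 _ _) _; first by [].
rewrite rnormN mulrDl; apply: lerD; last exact: hK2.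
apply: le_trans (hK1 c) _; rewrite -!mulrA ler_wpM2l //.
apply: le_trans (EGn (j2 c)) _; rewrite ler_wpM2l //.
have -> : bd2 s rels (j2 c) = j1 (bd2 t relsH c) := jE c.
exact: hK3.
Qed.

Lemma finitely_presented_subgroup_hyperbolic :
    has_projective_resolution (trivial_module rat G) 2 -> hyperbolic G ->
  finitely_presented H -> hyperbolic H.
Proof.
move=> pd2 [n [s [hs hyp]]] [k [t [rels pres]]].
have [E [K [K0 bdE En]]] := subgroup_bounded_section pd2 hyp pres.
exists k, t, pres.1.
have [kappa k1 hw] := geodesic_path_weight pres.1 K0
  (bd1_bd2 (presentation_relators pres)) (presentation_exact pres) bdE En.
have [R slim] := slim_of_path_weight k1 hw.
exact: hyperbolic_of_slim slim.
Qed.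

End Subgroup.

(** * Extension of scalars from Z to Q *)

Section FixedSubmodule.
Variables (S : nzRingType) (M : lmodType S) (E : {linear M -> M}).

Definition fixed_by : {pred M} := [pred c | E c == c].

(** For an idempotent [E] this is its image, a direct summand. *)
Record fix_mod := FixMod { fix_val :> M; _ : fix_val \in fixed_by }.

HB.instance Definition _ := [isSub for fix_val].
HB.instance Definition _ := [Choice of fix_mod by <:].

Lemma fixed_by_closed : submod_closed fixed_by.
Proof.
split=> [|a x y]; first by rewrite inE linear0.
by rewrite !inE linearP => /eqP -> /eqP ->.
Qed.

HB.instance Definition _ := GRing.SubChoice_isSubLmodule.Build S M fixed_by
  fix_mod (GRing.submod_closed_semi fixed_by_closed).

Lemma fix_valE (x : fix_mod) : E (val x) = val x.
Proof. by have /eqP := valP x. Qed.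

Section Corestriction.
Variables (N : lmodType S) (f : {linear N -> M}).
Hypothesis fE : forall x, E (f x) = f x.

Lemma corestr_subproof x : f x \in fixed_by.
Proof. by rewrite inE fE. Qed.

Definition corestr x : fix_mod := FixMod (corestr_subproof x).

Lemma corestr_is_linear : linear corestr.
Proof. by move=> a x y; apply: val_inj; rewrite linearP /= linearP. Qed.

HB.instance Definition _ := GRing.isLinear.Build S N fix_mod _ corestr
  corestr_is_linear.

End Corestriction.

End FixedSubmodule.

Lemma fix_mod_projective (S : nzRingType) (X : choiceType)
    (E : {linear {malg S[X]} -> {malg S[X]}}) :
  (forall x, E (E x) = E x) -> projective (fix_mod E).
Proof.
move=> EE; apply: (projective_of_section (g := \val) (p := corestr EE)) => x.
by apply: val_inj; rewrite /= fix_valE.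
Qed.

Section Rationalize.
Variable G : groupType.
Local Notation SZ := (group_ring int G).
Local Notation SQ := (group_ring rat G).

Definition rationalize : SZ -> SQ := gext (fun q g => mono q%:~R g).

Lemma rationalize_mono q g : rationalize (mono q g) = mono q%:~R g.
Proof. by apply: gext_mono => *; rewrite intrD monoD. Qed.

Lemma rationalizeD : {morph rationalize : a b / a + b}.
Proof. by apply: gextD => *; rewrite intrD monoD. Qed.

Lemma rationalizeM : {morph rationalize : a b / a * b}.
Proof.
move=> a b; elim/mono_ind: a => [|a a' IH IH'|q g].
- by rewrite mul0r (morph_add0 rationalizeD) mul0r.
- by rewrite mulrDl !rationalizeD IH IH' mulrDl.
elim/mono_ind: b => [|b b' IH IH'|r h].
- by rewrite mulr0 (morph_add0 rationalizeD) mulr0.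
- by rewrite mulrDr !rationalizeD IH IH' mulrDr.
- by rewrite monoM !rationalize_mono monoM intrM.
Qed.

Lemma rationalize1 : rationalize 1 = 1.
Proof. by rewrite -mono1 rationalize_mono mono1. Qed.

Lemma mcoeff_rationalize a g : (rationalize a)@_g = (a@_g)%:~R.
Proof.
elim/mono_ind: a => [|a b IH IH'|q h].
- by rewrite (morph_add0 rationalizeD) !mcoeff0.
- by rewrite rationalizeD !mcoeffD IH IH' intrD.
- by rewrite rationalize_mono !mcoeff_mono; case: (_ == _).
Qed.

Lemma rationalize_inj a : rationalize a = 0 -> a = 0.
Proof.
move=> a0; apply/malgP => g; apply/eqP; rewrite mcoeff0 -(intr_eq0 rat).
by rewrite -mcoeff_rationalize a0 mcoeff0.
Qed.

Lemma augmentation_rationalize a :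
  augmentation (rationalize a) = (augmentation a)%:~R.
Proof.
elim/mono_ind: a => [|a b IH IH'|q h].
- by rewrite (morph_add0 rationalizeD) !augmentation0.
- by rewrite rationalizeD !augmentationD IH IH' intrD.
- by rewrite rationalize_mono !augmentation_mono.
Qed.

Lemma clear_denominators_add (U V : zmodType) (i : U -> V) (x y : V) :
  {morph i : a b / a + b} ->
  (exists (N : nat) a, (0 < N)%N /\ x *+ N = i a) ->
  (exists (N : nat) a, (0 < N)%N /\ y *+ N = i a) ->
  (exists (N : nat) a, (0 < N)%N /\ (x + y) *+ N = i a).
Proof.
move=> iD [N [a [N0 xa]]] [N' [b [N0' yb]]].
have iMn c k : i (c *+ k) = i c *+ k.
  by elim: k => [|k IH]; rewrite ?mulr0n ?(morph_add0 iD) // !mulrS iD IH.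
exists (N * N')%N, (a *+ N' + b *+ N); rewrite muln_gt0 N0; split=> //.
by rewrite iD !iMn -xa -yb mulrnDl -!mulrnA (mulnC N').
Qed.

Lemma rationalize_denom a :
  exists (N : nat) b, (0 < N)%N /\ a *+ N = rationalize b.
Proof.
elim/mono_ind: a => [|a b IH IH'|q g].
- by exists 1%N, 0; rewrite (morph_add0 rationalizeD).
- by apply: clear_denominators_add IH IH'; apply: rationalizeD.
exists `|denq q|%N, (mono (numq q) g); rewrite absz_gt0 denq_neq0; split=> //.
rewrite rationalize_mono monoMn; congr (mono _ _).
by rewrite numqE -mulr_natr -[in RHS]absz_denq.
Qed.

Lemma monoZ_Mn (N : nat) (M : lmodType SQ) (x : M) : (0 < N)%N ->
  mono (N%:R^-1) 1%g *: (x *+ N) = x.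
Proof.
move=> N0; rewrite -scalerMnr scalerMnl monoMn -[_ *+ N]mulr_natr.
by rewrite mulVf ?pnatr_eq0 -?lt0n // mono1 scale1r.
Qed.

Section Free.
Variable X : choiceType.

Definition rat_chain (c : {malg SZ[X]}) : {malg SQ[X]} :=
  \sum_(x <- msupp c) << rationalize c@_x *g x >>.

Lemma mcoeff_rat_chain c x : (rat_chain c)@_x = rationalize c@_x.
Proof.
rewrite /rat_chain raddf_sum /=; case: (msuppP c x) => xc.
  rewrite (big_fsetD1 x) //= mcoeffUU big_seq big1 ?addr0 // => y.
  by rewrite !inE mcoeffU => /andP[/negPf ->].
rewrite (morph_add0 rationalizeD) big_seq big1 // => y yc; rewrite mcoeffU.
by case: eqP xc => // <-; rewrite yc.
Qed.

Lemma rat_chainD : {morph rat_chain : b c / b + c}.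
Proof.
move=> b c; apply/malgP => x.
by rewrite mcoeffD !mcoeff_rat_chain mcoeffD rationalizeD.
Qed.

Lemma rat_chainZ a c : rat_chain (a *: c) = rationalize a *: rat_chain c.
Proof.
apply/malgP => x.
by rewrite mcoeffZ !mcoeff_rat_chain mcoeffZ rationalizeM.
Qed.

Lemma rat_chainU x : rat_chain << 1 *g x >> = << 1 *g x >>.
Proof.
apply/malgP => y; rewrite mcoeff_rat_chain !mcoeffU.
by case: eqP => _; rewrite ?rationalize1 ?(morph_add0 rationalizeD).
Qed.

Lemma rat_chain_inj c : rat_chain c = 0 -> c = 0.
Proof.
move=> c0; apply/malgP => x; rewrite mcoeff0; apply: rationalize_inj.
by rewrite -mcoeff_rat_chain c0 mcoeff0.
Qed.

Lemma rat_chain_denom c :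
  exists (N : nat) b, (0 < N)%N /\ c *+ N = rat_chain b.
Proof.
rewrite [c]monalgE; elim/big_ind: _ => [|b b' IH IH'|x _].
- by exists 1%N, 0; rewrite (morph_add0 rat_chainD).
- by apply: clear_denominators_add IH IH'; apply: rat_chainD.
have [N [b [N0 bE]]] := rationalize_denom c@_x; exists N, << b *g x >>.
split=> //; rewrite -monalgUMn bE; apply/malgP => y.
rewrite mcoeff_rat_chain !mcoeffU.
by case: eqP => _; rewrite ?(morph_add0 rationalizeD).
Qed.

End Free.

(* M -> MQ plays the role of the localization M -> Q (x) M.                   *)
Section BaseChange.
Variables (X : choiceType) (M : lmodType SZ) (MQ : lmodType SQ) (i : M -> MQ).
Hypothesis iD : {morph i : a b / a + b}.
Hypothesis iZ : forall a x, i (a *: x) = rationalize a *: i x.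

Definition base_change (f : {malg SZ[X]} -> M) : {linear {malg SQ[X]} -> MQ} :=
  free_ext (fun x => i (f << 1 *g x >>)).

Lemma base_changeE (f : {linear {malg SZ[X]} -> M}) c :
  base_change f (rat_chain c) = i (f c).
Proof.
rewrite (linear_free_ext f) [LHS](@free_extw _ _ _ _ (msupp c)).
  rewrite /free_ext (morph_add_sum _ _ iD); apply: eq_bigr => x _.
  by rewrite iZ mcoeff_rat_chain.
apply/fsubsetP => x; rewrite -!mcoeff_neq0 mcoeff_rat_chain.
by apply: contra_neq => ->; rewrite (morph_add0 rationalizeD).
Qed.

End BaseChange.

Lemma linear_rat_chain_eq (X : choiceType) (MQ : lmodType SQ)
    (f g : {linear {malg SQ[X]} -> MQ}) :
  (forall x, f (rat_chain << 1 *g x >>) = g (rat_chain << 1 *g x >>)) ->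
  f =1 g.
Proof.
move=> fg c; rewrite (linear_free_ext f) (linear_free_ext g).
by apply: eq_bigr => x _; have := fg x; rewrite rat_chainU => ->.
Qed.

End Rationalize.

Section RationalResolution.
Variable G : groupType.
Local Notation SZ := (group_ring int G).
Local Notation SQ := (group_ring rat G).

Lemma linear_rat_chain_eq0 (X : choiceType) (MQ : lmodType SQ)
    (f : {linear {malg SQ[X]} -> MQ}) :
  (forall x, f (rat_chain << 1 *g x >>) = 0) -> forall c, f c = 0.
Proof.
move=> f0 c; rewrite (linear_free_ext f) /free_ext big1 // => x _.
by have := f0 x; rewrite rat_chainU => ->; rewrite scaler0.
Qed.

Local Notation base_rat := (base_change (@rat_chain G _)).

Lemma base_ratE (X Y : choiceType) (f : {linear {malg SZ[X]} -> {malg SZ[Y]}}) c :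
  base_rat f (rat_chain c) = rat_chain (f c).
Proof. by apply: base_changeE; [apply: rat_chainD | apply: rat_chainZ]. Qed.

Definition free_map (A B : lmodType SZ) (sB : {linear B -> {malg SZ[B]}})
    (f : {linear A -> B}) : {linear {malg SZ[A]} -> {malg SZ[B]}} :=
  sB \o f \o free_ext id.

Definition rat_map (A B : lmodType SZ) (sB : {linear B -> {malg SZ[B]}})
    (f : {linear A -> B}) : {linear {malg SQ[A]} -> {malg SQ[B]}} :=
  base_rat (free_map sB f).

Lemma rat_mapE (A B : lmodType SZ) (sB : {linear B -> {malg SZ[B]}})
    (f : {linear A -> B}) c :
  rat_map sB f (rat_chain c) = rat_chain (sB (f (free_ext id c))).
Proof. exact: base_ratE. Qed.

Section Projector.
Variables (B : lmodType SZ) (sB : {linear B -> {malg SZ[B]}}).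
Hypothesis sBK : forall x, free_ext id (sB x) = x.

(* The rationalization of B is the image of the idempotent rat_proj.          *)
Definition rat_proj : {linear {malg SQ[B]} -> {malg SQ[B]}} := rat_map sB idfun.

Lemma rat_projE c : rat_proj (rat_chain c) = rat_chain (sB (free_ext id c)).
Proof. by rewrite /rat_proj rat_mapE. Qed.

Lemma rat_proj_map (A : lmodType SZ) (f : {linear A -> B}) c :
  rat_proj (rat_map sB f c) = rat_map sB f c.
Proof.
apply: (linear_rat_chain_eq (f := rat_proj \o rat_map sB f)) => x /=.
by rewrite !rat_mapE rat_projE sBK.
Qed.

Lemma rat_proj_idem c : rat_proj (rat_proj c) = rat_proj c.
Proof. exact: rat_proj_map. Qed.

Lemma rat_proj_section b : rat_proj (rat_chain (sB b)) = rat_chain (sB b).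
Proof. by rewrite rat_projE sBK. Qed.

Lemma rat_proj0 : (forall x : B, x = 0) -> forall c, rat_proj c = 0.
Proof.
move=> B0; apply: linear_rat_chain_eq0 => x.
rewrite rat_projE (B0 (free_ext _ _)) linear0.
exact: morph_add0 (@rat_chainD _ _).
Qed.

End Projector.

(** Flatness of Q by hand: multiply a cycle by a common denominator, use exactness over the
    integers, and divide again. The injectivity of [i] says that [M] has no torsion lost in [MQ]. *)
Lemma rat_exact (A B : lmodType SZ) (sA : {linear A -> {malg SZ[A]}})
    (sB : {linear B -> {malg SZ[B]}}) (M : lmodType SZ) (MQ : lmodType SQ)
    (i : M -> MQ) (f : {linear A -> B}) (h : {linear B -> M}) :
    (forall x, free_ext id (sA x) = x) -> (forall x, free_ext id (sB x) = x) ->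
    {morph i : a b / a + b} -> (forall a x, i (a *: x) = rationalize a *: i x) ->
    (forall x, i x = 0 -> x = 0) -> exact_at f h ->
  forall c, rat_proj sB c = c ->
    base_change i (h \o free_ext id) c = 0 <->
    exists2 b, rat_proj sA b = b & rat_map sB f b = c.
Proof.
move=> sAK sBK iD iZ i_inj ex c cE.
pose hQ := base_change i (h \o free_ext id).
have hQE x : hQ (rat_chain x) = i (h (free_ext id x)).
  by rewrite /hQ (base_changeE iD iZ).
split=> [c0|[b _ <-]]; last first.
  apply: (linear_rat_chain_eq0 (f := hQ \o rat_map sB f)) => x /=.
  rewrite rat_mapE hQE sBK.
  have -> : h (f (free_ext id << 1 *g x >>)) = 0 by apply/ex; eexists.
  exact: morph_add0 iD.
have [N [c' [N0 cc']]] := rat_chain_denom c.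
have /i_inj /ex[a fa] : i (h (free_ext id c')) = 0.
  by rewrite -hQE -cc' linearMn [hQ c]c0 mul0rn.
exists (mono N%:R^-1 1%g *: rat_chain (sA a)).
  by rewrite linearZ /= rat_proj_section.
rewrite linearZ /= rat_mapE sAK fa -rat_projE -cc' linearMn cE.
exact: monoZ_Mn.
Qed.

Definition intr_trivial : trivial_module int G -> trivial_module rat G :=
  fun x => (x : int)%:~R.

(** Each projective module is the image of an idempotent on a free module. The same idempotent with
    rational coefficients has as image the extension of scalars, which is again projective and
    vanishes when the original does. *)
Lemma has_projective_resolution_rat n :
  has_projective_resolution (trivial_module int G) n ->
  has_projective_resolution (trivial_module rat G) n.
Proof.
move=> [P [d [e [[projP e_surj ex0 ex] P0]]]].
pose s i := projT1 (cid (projective_section (projP i))).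
have sK i x : free_ext id (s i x) = x.
  by rewrite /s; case: (cid _) => /= g; apply.
pose d' i : {linear fix_mod (rat_proj (s i.+1)) -> fix_mod (rat_proj (s i))} :=
  corestr (rat_proj_map (sK i) (d i)) \o \val.
pose e' : {linear fix_mod (rat_proj (s 0%N)) -> trivial_module rat G} :=
  base_change intr_trivial (e \o free_ext id) \o \val.
have iD : {morph intr_trivial : a b / a + b} by move=> a b; apply: intrD.
have iZ a x : intr_trivial (a *: x) = rationalize a *: intr_trivial x.
  rewrite -[RHS]/(augmentation (rationalize a) * _) augmentation_rationalize.
  exact: intrM.
have i_inj x : intr_trivial x = 0 -> x = 0.
  by move=> /eqP; rewrite intr_eq0 => /eqP.
exists (fun i => fix_mod (rat_proj (s i))), d', e'; split; first split.
- by move=> i; apply: fix_mod_projective; apply: rat_proj_idem.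
- move=> q; have [x ex1] := e_surj (1 : int).
  have pf : rat_chain (s 0%N x) \in fixed_by (rat_proj (s 0%N)).
    by rewrite inE rat_proj_section.
  exists (mono q 1%g *: FixMod pf); rewrite linearZ.
  have -> : e' (FixMod pf) = intr_trivial (e (free_ext id (s 0%N x))).
    exact: (base_changeE iD iZ (e \o free_ext id)).
  rewrite sK ex1.
  by rewrite -[LHS]/(augmentation (mono q 1%g) * _) augmentation_mono mulr1.
- move=> b.
  have := rat_exact (sK 1%N) (sK 0%N) iD iZ i_inj ex0 (fix_valE b).
  move=> h; split=> [/h[a aE ab]|[a <-]].
    have pf : a \in fixed_by (rat_proj (s 1%N)) by rewrite inE aE.
    by exists (FixMod pf); apply: val_inj.
  by apply/(rat_exact (sK 1%N) (sK 0%N) iD iZ i_inj ex0 (fix_valE _));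
    exists (val a); rewrite ?fix_valE.
- move=> i b.
  (* Composing with the injective section [s i] keeps the kernel and puts the target in a free
     module, where [rat_chain] serves as the localization. *)
  have ex' : exact_at (d i.+1) (s i \o d i).
    move=> x; split=> [x0|[a <-]] /=.
      by apply/ex; rewrite -(sK i (d i x)) [s i _]x0 linear0.
    by rewrite (_ : d i (d i.+1 a) = 0) ?linear0 //; apply/ex; exists a.
  have h := rat_exact (sK i.+2) (sK i.+1) (@rat_chainD _ _) (@rat_chainZ _ _)
    (@rat_chain_inj _ _) ex' .
  split=> [b0|[a <-]].
    have /(h _ (fix_valE b))[a aE ab] : rat_map (s i) (d i) (val b) = 0.
      exact: (congr1 val b0).
    have pf : a \in fixed_by (rat_proj (s i.+2)) by rewrite inE aE.
    by exists (FixMod pf); apply: val_inj.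
  apply: val_inj; apply/(h _ (fix_valE (d' i.+1 a))).
  by exists (val a); rewrite ?fix_valE.
- move=> i ni x; apply: val_inj; rewrite -fix_valE.
  by rewrite rat_proj0 //; apply: P0.
Qed.

End RationalResolution.

(** * Comparing the two dimensions *)

Lemma projective_dimension_le (S : nzRingType) (M : lmodType S) (n : nat) :
  has_projective_resolution M n ->
  exists2 m, projective_dimension M = Some m & (m <= n)%N.
Proof.
move=> hn; rewrite /projective_dimension; case: pselect => [h|[]]; last first.
  by exists n; apply/asboolP.
exists (ex_minn h) => //; case: ex_minnP => m _; apply.
exact/asboolP.
Qed.

Lemma projective_dimension_resolution (S : nzRingType) (M : lmodType S)
    (n m : nat) :
  projective_dimension M = Some n -> (n <= m)%N -> has_projective_resolution M m.
Proof.
rewrite /projective_dimension; case: pselect => // h [<-].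
case: ex_minnP => k /asboolP[P [d [e [res P0]]]] _ km.
exists P, d, e; split=> // i mi; apply: P0; exact: leq_ltn_trans km mi.
Qed.

Local Close Scope ring_scope.

Theorem corollary1p4 (G : groupType) (hG : hyperbolic G)
    (hcd : cd int G = Some 3)
    (hsub : exists (P : pred G) (H : subGroupType P),
      finitely_presented H /\ ~ hyperbolic H) :
  cd rat G = cd int G.
Proof.
rewrite hcd; have [m cdm m3] := projective_dimension_le
  (has_projective_resolution_rat (projective_dimension_resolution hcd (leqnn 3))).
have [m2|m2] := leqP m 2; last by rewrite [LHS]cdm; congr Some; lia.
have [P [H [fpH []]]] := hsub.
exact: finitely_presented_subgroup_hyperbolic
  (projective_dimension_resolution cdm m2) hG fpH.
Qed.
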